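(* Let $H=kG(\chi,a,\delta)$ be a Hopf-Ore extension of the group algebra $kG$ with (normalized) generator $x$, let $q=\chi(a)$, let $H_0\subseteq H_1\subseteq\cdots$ be the coradical filtration of $H$ (so that $H_0=kG$). (a) Assume $\mathrm{char}(k)=0$. If $q$ is a primitive $n$-th root of unity for some $n\geq 2$, then the rank of $H$ is $2$ and $H_1=H_0\oplus H_0x\oplus H_0x^n$; otherwise, the rank of $H$ is $1$ and $H_1=H_0\oplus H_0x$. (b) Assume $\mathrm{char}(k)=p>0$. If $q$ is a primitive $N$-th root of unity for some $N\geq 2$, then the rank of $H$ is infinite and $H_1=H_0\oplus H_0x\oplus\left(\bigoplus_{r\geq 0}H_0x^{Np^r}\right)$; if $q=1$, then the rank of $H$ is infinite and $H_1=H_0\oplus\left(\bigoplus_{r\geq 0}H_0x^{p^r}\right)$; otherwise, the rank of $H$ is $1$ and $H_1=H_0\oplus H_0x$.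
   Context: $k$ is an arbitrary field, $G$ is a group, $\chi:G\to k^{\times}$ is a character (group homomorphism), $a\in Z(G)$ (the center of $G$), and $\alpha:kG\to k$ is a linear map that is a $1$-cocycle with respect to $\chi$: $\alpha(gh)=\alpha(g)+\chi(g)\alpha(h)$ for all $g,h\in G$. Put $\delta(g)=g(1-a)\alpha(g)$ for $g\in G$ (extended linearly). The Hopf-Ore extension $kG(\chi,a,\delta)$ is the Hopf algebra generated as an algebra by $kG$ and a variable $x$ with relations $xg=\chi(g)gx+\delta(g)$, i.e. $g^{-1}xg=\chi(g)x+\alpha(g)(1-a)$ ($g\in G$); it has $k$-basis $\{gx^i\mid g\in G,\ i\geq 0\}$, contains $kG$ as a Hopf subalgebra (each $g\in G$ is group-like), and $\Delta(x)=x\otimes a+1\otimes x$, $\varepsilon(x)=0$, $S(x)=-xa^{-1}$. Normalization of the generator: if $\chi(a)\neq 1$, the generator $x$ is chosen (replacing $x$ by $x-\frac{\alpha(a)}{1-\chi(a)}(1-a)$ if necessary) so that $\alpha=0$, i.e. $g^{-1}xg=\chi(g)x$ for all $g\in G$. If $\chi(a)=1$ and $\alpha(a)=0$, then $a^{-1}xa=x$. If $\chi(a)=1$ and $\alpha(a)\neq 0$, then $x$ is rescaled so that $a^{-1}xa=x+(1-a)$. Rank: let $H$ be a Hopf algebra with coradical filtration $H_0\subseteq H_1\subseteq\cdots$ such that $H_0$ is a Hopf subalgebra. If $H$ is generated by $H_1$ as an algebra and $\dim_k(k\otimes_{H_0}H_1)=n+1$ (with $k$ the trivial $H_0$-module via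 the counit and $H_1$ a left $H_0$-module by multiplication), then $H$ is said to have rank $n$; the rank is infinite if this dimension is infinite. *)

(* Defs.v *)
From HB Require Import structures.
From mathcomp Require Import all_boot all_order all_algebra.
From mathcomp Require Import generic_quotient sesquilinear.
From mathcomp Require Import boolp classical_sets.

Set Implicit Arguments.
Unset Strict Implicit.
Unset Printing Implicit Defensive.

Import GRing.Theory.

Local Open Scope quotient_scope.
Local Open Scope classical_set_scope.
Local Open Scope ring_scope.

(* The tensor product of two vector spaces: finite formal sums of pairs        *)
(* (v, w), two of them being identified when every bilinear map takes the same *)
(* value on both.  Scalars need no separate coefficient since                  *)
(* c (v (x) w) = (c v) (x) w.  tliftE and tlift_unique below are the universal *)
(* property.                                                                   *)
Section TensorProduct.
Variables (k : fieldType) (V W : lmodType k).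
Implicit Type U : lmodType k.

Definition bilinear_map (U : lmodType k) (b : V -> W -> U) : Prop :=
  bilinear_for *:%R *:%R b.

Definition formal_sum := seq (V * W).

Definition sum_eval (U : lmodType k) (b : V -> W -> U) (s : formal_sum) : U :=
  \sum_(p <- s) b p.1 p.2.

Definition formal_sum_eq (s t : formal_sum) : bool :=
  `[< forall (U : lmodType k) (b : V -> W -> U),
        bilinear_map b -> sum_eval b s = sum_eval b t >].

Lemma formal_sum_eqP (s t : formal_sum) :
  reflect (forall (U : lmodType k) (b : V -> W -> U),
             bilinear_map b -> sum_eval b s = sum_eval b t)
          (formal_sum_eq s t).
Proof. exact: asboolP. Qed.

Lemma formal_sum_eq_refl : reflexive formal_sum_eq.
Proof. by move=> s; apply/formal_sum_eqP. Qed.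

Lemma formal_sum_eq_sym : symmetric formal_sum_eq.
Proof.
by move=> s t; apply/formal_sum_eqP/formal_sum_eqP => h U b bb; rewrite h.
Qed.

Lemma formal_sum_eq_trans : transitive formal_sum_eq.
Proof.
move=> s t u /formal_sum_eqP h1 /formal_sum_eqP h2.
by apply/formal_sum_eqP => U b bb; rewrite h1 // h2.
Qed.

Canonical formal_sum_equiv := EquivRel formal_sum_eq
  formal_sum_eq_refl formal_sum_eq_sym formal_sum_eq_trans.

Definition tensor : Type := {eq_quot formal_sum_equiv}.
HB.instance Definition _ :=
  Choice.copy tensor {eq_quot formal_sum_equiv}.

Definition tclass (s : formal_sum) : tensor := \pi_({eq_quot formal_sum_equiv}) s.
Definition trepr (t : tensor) : formal_sum :=
  repr (t : {eq_quot formal_sum_equiv}).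

Lemma treprK : cancel trepr tclass.
Proof. exact: (@reprK _ {eq_quot formal_sum_equiv}). Qed.

Definition tens (v : V) (w : W) : tensor := tclass [:: (v, w)].

(* Only meaningful for bilinear b. *)
Definition tlift (U : lmodType k) (b : V -> W -> U) (t : tensor) : U :=
  sum_eval b (trepr t).

Lemma tlift_class (U : lmodType k) (b : V -> W -> U) (s : formal_sum) :
  bilinear_map b -> tlift b (tclass s) = sum_eval b s.
Proof.
move=> bb; rewrite /tlift.
have /formal_sum_eqP -> // : formal_sum_eq (trepr (tclass s)) s.
by apply/eqmodP; rewrite /trepr reprK.
Qed.

Lemma tensorP (t u : tensor) :
  (forall (U : lmodType k) (b : V -> W -> U),
     bilinear_map b -> tlift b t = tlift b u) -> t = u.
Proof.
move=> h; rewrite -[t]treprK -[u]treprK; apply/eqmodP/formal_sum_eqP.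
exact: h.
Qed.

Definition tzero := tclass [::].
Definition tadd (t u : tensor) := tclass (trepr t ++ trepr u).
Definition tscale (c : k) (t : tensor) :=
  tclass [seq (c *: p.1, p.2) | p <- trepr t].
Definition topp (t : tensor) := tscale (-1) t.

Lemma tlift_zero U (b : V -> W -> U) : bilinear_map b -> tlift b tzero = 0.
Proof. by move=> bb; rewrite tlift_class // /sum_eval big_nil. Qed.

Lemma tlift_add U (b : V -> W -> U) t u :
  bilinear_map b -> tlift b (tadd t u) = tlift b t + tlift b u.
Proof. by move=> bb; rewrite tlift_class // /sum_eval big_cat. Qed.

Lemma bilinear_map0l U (b : V -> W -> U) w : bilinear_map b -> b 0 w = 0.
Proof.
by move=> bb; have := bb.1 w (-1) 0 0; rewrite /= scaler0 addr0 scaleN1r addNr.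
Qed.

Lemma bilinear_mapZl U (b : V -> W -> U) c v w :
  bilinear_map b -> b (c *: v) w = c *: b v w.
Proof.
move=> bb; have := bb.1 w c v 0; rewrite /= !addr0 => ->.
by rewrite bilinear_map0l // addr0.
Qed.

Lemma tlift_scale U (b : V -> W -> U) c t :
  bilinear_map b -> tlift b (tscale c t) = c *: tlift b t.
Proof.
move=> bb; rewrite tlift_class // /tlift /sum_eval big_map scaler_sumr.
by apply: eq_bigr => p _; exact: bilinear_mapZl.
Qed.

Lemma tlift_opp U (b : V -> W -> U) t :
  bilinear_map b -> tlift b (topp t) = - tlift b t.
Proof. by move=> bb; rewrite tlift_scale // scaleN1r. Qed.

Fact taddA : associative tadd.
Proof. by move=> *; apply: tensorP => U b bb; rewrite !tlift_add // addrA. Qed.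
Fact taddC : commutative tadd.
Proof. by move=> *; apply: tensorP => U b bb; rewrite !tlift_add // addrC. Qed.
Fact tadd0 : left_id tzero tadd.
Proof.
by move=> *; apply: tensorP => U b bb; rewrite tlift_add // tlift_zero // add0r.
Qed.
Fact taddN : left_inverse tzero topp tadd.
Proof.
move=> *; apply: tensorP => U b bb.
by rewrite tlift_add // tlift_opp // tlift_zero // addNr.
Qed.
HB.instance Definition _ :=
  GRing.isZmodule.Build tensor taddA taddC tadd0 taddN.

Fact tscaleA c d t : tscale c (tscale d t) = tscale (c * d) t.
Proof. by apply: tensorP => U b bb; rewrite !tlift_scale // scalerA. Qed.
Fact tscale1 : left_id 1 tscale.
Proof. by move=> *; apply: tensorP => U b bb; rewrite tlift_scale // scale1r. Qed.
Fact tscaleDr : right_distributive tscale +%R.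
Proof.
move=> *; apply: tensorP => U b bb.
by rewrite tlift_scale // !tlift_add // !tlift_scale // scalerDr.
Qed.
Fact tscaleDl t : {morph tscale^~ t : c d / c + d >-> c + d}.
Proof.
move=> c d; apply: tensorP => U b bb.
by rewrite tlift_add // !tlift_scale // scalerDl.
Qed.
HB.instance Definition _ :=
  GRing.Zmodule_isLmodule.Build k tensor tscaleA tscale1 tscaleDr tscaleDl.

Lemma tlift_linear U (b : V -> W -> U) : bilinear_map b -> linear (tlift b).
Proof. by move=> bb c t u; rewrite tlift_add // tlift_scale. Qed.

Lemma tliftE U (b : V -> W -> U) v w :
  bilinear_map b -> tlift b (tens v w) = b v w.
Proof. by move=> bb; rewrite tlift_class // /sum_eval big_seq1. Qed.

Lemma tens_bilinear : bilinear_map tens.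
Proof.
split=> [w c u v|v c u w] /=; apply: tensorP => U b bb;
  rewrite tlift_linear // !tliftE //.
- exact: bb.1.
- exact: bb.2.
Qed.

Lemma tensor_sum (t : tensor) : t = \sum_(p <- trepr t) tens p.1 p.2.
Proof.
rewrite -{1}[t]treprK; elim: (trepr t) => [|p s IH]; first by rewrite big_nil.
rewrite big_cons -IH; apply: tensorP => U b bb.
by rewrite tlift_add // tliftE // !tlift_class // /sum_eval big_cons.
Qed.

Lemma tlift_unique (U : lmodType k) (b : V -> W -> U) (f : tensor -> U) :
  linear f -> (forall v w, f (tens v w) = b v w) -> f =1 tlift b.
Proof.
move=> flin fb t; rewrite {1}(tensor_sum t) /tlift /sum_eval.
pose F := HB.pack_for {linear tensor -> U} f
  (GRing.isLinear.Build k tensor U *:%R f flin).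
rewrite -[f]/(F : tensor -> U) linear_sum.
by apply: eq_bigr => p _; exact: fb.
Qed.

End TensorProduct.

Notation "v ⊗ w" := (tens v w) (at level 40, left associativity) : ring_scope.

Section TensorMaps.
Variable k : fieldType.

Definition tmap (V V' W W' : lmodType k) (f : V -> V') (g : W -> W') :
  tensor V W -> tensor V' W' := tlift (fun v w => f v ⊗ g w).

Definition tassoc (U V W : lmodType k) :
  tensor (tensor U V) W -> tensor U (tensor V W) :=
  tlift (fun t w => tlift (fun u v => u ⊗ (v ⊗ w)) t).

End TensorMaps.

(* The tensor product of two algebras, (a (x) b)(c (x) d) = ac (x) bd. *)
Section TensorAlgebra.
Variables (k : fieldType) (A B : algType k).
Local Notation T := (tensor A B).

Definition tone : T := 1 ⊗ 1.
Definition tmul (t u : T) : T :=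
  tlift (fun a b => tlift (fun c d => (a * c) ⊗ (b * d)) u) t.

Lemma tmul_bilinear_in (U : lmodType k) (f : A -> B -> U) a b :
  bilinear_map f -> bilinear_map (fun c d => f (a * c) (b * d)).
Proof.
move=> bf; split=> [d c u v|c e u v] /=; rewrite mulrDr -scalerAr.
- exact: bf.1.
- exact: bf.2.
Qed.

Lemma tmul_bilinear_out (U : lmodType k) (f : A -> B -> U) u :
  bilinear_map f ->
  bilinear_map (fun a b => tlift (fun c d => f (a * c) (b * d)) u).
Proof.
move=> bf; split=> [b e v w|a e v w] /=;
  rewrite /tlift /sum_eval scaler_sumr -big_split; apply: eq_bigr => p _ /=;
  rewrite mulrDl -scalerAl.
- exact: bf.1.
- exact: bf.2.
Qed.

Lemma tlift_mul (U : lmodType k) (f : A -> B -> U) t u : bilinear_map f ->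
  tlift f (tmul t u) =
  tlift (fun a b => tlift (fun c d => f (a * c) (b * d)) u) t.
Proof.
move=> bf; rewrite /tmul.
have tb := @tens_bilinear k A B.
pose F := HB.pack_for {linear T -> U} (tlift f)
  (GRing.isLinear.Build k T U *:%R (tlift f) (tlift_linear bf)).
rewrite -[tlift f _]/(F _) {1}/tlift /sum_eval linear_sum.
apply: eq_bigr => p _; rewrite {1}/tlift /sum_eval linear_sum.
by apply: eq_bigr => q _; rewrite /= tliftE.
Qed.

Lemma eq_tlift (V W U : lmodType k) (f g : V -> W -> U) (t : tensor V W) :
  (forall a b, f a b = g a b) -> tlift f t = tlift g t.
Proof. by move=> fg; apply: eq_bigr. Qed.

Lemma tens_mul a b c d : tmul (a ⊗ b) (c ⊗ d) = (a * c) ⊗ (b * d).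
Proof.
have tb := @tens_bilinear k A B.
rewrite /tmul tliftE; last exact: tmul_bilinear_out.
by rewrite tliftE //; exact: tmul_bilinear_in.
Qed.

Fact tmulA : associative tmul.
Proof.
move=> t u v; apply: tensorP => U f bf; rewrite !tlift_mul //; last first.
  exact: tmul_bilinear_out.
apply: eq_tlift => a b; rewrite tlift_mul; last exact: tmul_bilinear_in.
by apply: eq_tlift => c d; apply: eq_tlift => e g; rewrite !mulrA.
Qed.

Fact tmul1l : left_id tone tmul.
Proof.
move=> t; apply: tensorP => U f bf; rewrite tlift_mul // tliftE.
  by apply: eq_tlift => a b; rewrite !mul1r.
exact: tmul_bilinear_out.
Qed.

Fact tmul1r : right_id tone tmul.
Proof.
move=> t; apply: tensorP => U f bf; rewrite tlift_mul //.
apply: eq_tlift => a b; rewrite tliftE ?mulr1 //.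
exact: tmul_bilinear_in.
Qed.

Fact tmulDl : left_distributive tmul +%R.
Proof.
move=> t u v; apply: tensorP => U f bf.
by rewrite tlift_mul // !tlift_add // ?tlift_mul //; exact: tmul_bilinear_out.
Qed.

Fact tmulDr : right_distributive tmul +%R.
Proof.
move=> t u v; apply: tensorP => U f bf.
rewrite tlift_mul // tlift_add // !tlift_mul //.
rewrite -[RHS]big_split; apply: eq_bigr => p _ /=.
by rewrite tlift_add //; exact: tmul_bilinear_in.
Qed.

HB.instance Definition _ := GRing.Zmodule_isPzRing.Build (tensor A B)
  tmulA tmul1l tmul1r tmulDl tmulDr.

End TensorAlgebra.

Record hopfAlgebra (k : fieldType) := HopfAlgebra {
  hopf_sort :> algType k;
  comul : {linear hopf_sort -> tensor hopf_sort hopf_sort};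
  counit : {linear hopf_sort -> k^o};
  antipode : {linear hopf_sort -> hopf_sort};
  comul_morphism : monoid_morphism comul;
  counit_morphism : monoid_morphism (counit : hopf_sort -> k);
  comulA : forall h,
    tassoc (tmap comul id (comul h)) = tmap id comul (comul h);
  counitl : forall h, tlift (fun u v => counit u *: v) (comul h) = h;
  counitr : forall h, tlift (fun u v => counit v *: u) (comul h) = h;
  antipodel : forall h,
    tlift (fun u v => antipode u * v) (comul h) = (counit h)%:A;
  antipoder : forall h,
    tlift (fun u v => u * antipode v) (comul h) = (counit h)%:A
}.


Section Subspaces.
Variables (k : fieldType) (V : lmodType k).

Definition subspace (A : set V) : Prop := submod_closed (mem A).

Definition lspan (A : set V) : set V := smallest subspace A.

Definition lin_indep (I : eqType) (b : I -> V) : Prop :=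
  forall (s : seq I) (c : I -> k), uniq s ->
    \sum_(i <- s) c i *: b i = 0 -> {in s, forall i, c i = 0}.

Definition is_basis (I : eqType) (b : I -> V) : Prop :=
  lin_indep b /\ lspan (range b) = setT.

(* W is the internal direct sum of the subspaces A i. *)
Definition is_direct_sum (I : eqType) (A : I -> set V) (W : set V) : Prop :=
  W = lspan (\bigcup_i A i) /\
  forall (s : seq I) (v : I -> V), uniq s -> (forall i, A i (v i)) ->
    \sum_(i <- s) v i = 0 -> {in s, forall i, v i = 0}.

(* For subspaces B `<=` A, the quotient A / B has dimension n: the classes of  *)
(* some v_1, ..., v_n in A form a basis of it.                                 *)
Definition quotient_dim (A B : set V) (n : nat) : Prop :=
  exists2 v : 'I_n -> V, forall i, A (v i) &
    forall u, A u -> exists! c : 'rV[k]_n, B (u - \sum_i c ord0 i *: v i).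

End Subspaces.

(* A (x) B as a subspace of V (x) W, for subspaces A of V and B of W. *)
Definition tensor_sub (k : fieldType) (V W : lmodType k)
    (A : set V) (B : set W) : set (tensor V W) :=
  lspan [set v ⊗ w | v in A & w in B].

Definition add_sub (k : fieldType) (V : lmodType k) (A B : set V) : set V :=
  [set u + v | u in A & v in B].

Section CoradicalFiltration.
Variables (k : fieldType) (H : hopfAlgebra k).

Definition subcoalgebra (D : set H) : Prop :=
  subspace D /\ forall d, D d -> tensor_sub D D (comul H d).

Definition simple_subcoalgebra (D : set H) : Prop :=
  [/\ subcoalgebra D, D <> [set 0] &
      forall E, subcoalgebra E -> E `<=` D -> E = [set 0] \/ E = D].

Definition coradical : set H :=
  lspan (\bigcup_(D in simple_subcoalgebra) D).

(* H_(n+1) is the wedge of H_0 and H_n. *)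
Fixpoint coradical_filtration (n : nat) : set H :=
  if n is m.+1 then
    comul H @^-1` (add_sub (tensor_sub setT (coradical_filtration m))
                           (tensor_sub coradical setT))
  else coradical.

Definition hopf_subalgebra (A : set H) : Prop :=
  [/\ subalg_closed (mem A),
      (forall h, A h -> tensor_sub A A (comul H h)) &
      (forall h, A h -> A (antipode H h))].

Definition generates (A : set H) : Prop :=
  smallest (fun B : set H => subalg_closed (mem B)) A = setT.

(* For a subalgebra A of H and a left A-submodule M of H, k (x)_A M is the     *)
(* quotient of k (x) M, taken inside k (x) H, by the elements                  *)
(* c.a (x) m - c (x) am, where A acts on k through the counit: c.a = c eps(a). *)
Definition balanced_relations (A M : set H) : set (tensor (k^o) H) :=
  lspan [set t | exists c : k^o, exists a m : H,
    [/\ A a, M m & t = (c * counit H a) ⊗ m - c ⊗ (a * m)]].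

Definition dim_trivial_tensor (A M : set H) (n : nat) : Prop :=
  quotient_dim (tensor_sub setT M) (balanced_relations A M) n.

Definition rank_defined : Prop :=
  hopf_subalgebra (coradical_filtration 0) /\
  generates (coradical_filtration 1).

Definition has_rank (n : nat) : Prop :=
  rank_defined /\
  dim_trivial_tensor (coradical_filtration 0) (coradical_filtration 1) n.+1.

Definition has_infinite_rank : Prop :=
  rank_defined /\
  forall n,
    ~ dim_trivial_tensor (coradical_filtration 0) (coradical_filtration 1) n.

End CoradicalFiltration.

Arguments coradical {k} H.
Arguments coradical_filtration {k} H n.
Arguments has_rank {k} H n.
Arguments has_infinite_rank {k} H.

(* chi takes its values in k^* because it is a morphism of monoids.  The       *)
(* linear map alpha : kG -> k is given by its values on the basis G of kG.     *)
Record hopfOreDatum (k : fieldType) (G : groupType) := HopfOreDatum {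
  ore_char : G -> k;
  ore_elt : G;
  ore_cocycle : G -> k;
  ore_char1 : ore_char 1%g = 1;
  ore_charM : forall g h : G, ore_char (g * h)%g = ore_char g * ore_char h;
  ore_elt_central : forall g : G, commute ore_elt g;
  ore_cocycleM : forall g h : G,
    ore_cocycle (g * h)%g = ore_cocycle g + ore_char g * ore_cocycle h
}.

(* kG(chi, a, delta); kG is embedded through gemb, and ore_rel is              *)
(* x g = chi(g) g x + delta(g) with delta(g) = g (1 - a) alpha(g).  An algebra *)
(* satisfying ore_rel and having the basis (g x^i) is the one presented by     *)
(* these relations.                                                            *)
Record hopfOreExtension (k : fieldType) (G : groupType)
    (D : hopfOreDatum k G) := HopfOreExtension {
  ore_hopf :> hopfAlgebra k;
  gemb : G -> ore_hopf;
  ore_var : ore_hopf;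
  gemb1 : gemb 1%g = 1;
  gembM : forall g h : G, gemb (g * h)%g = gemb g * gemb h;
  ore_rel : forall g : G,
    ore_var * gemb g =
      ore_char D g *: (gemb g * ore_var)
      + ore_cocycle D g *: (gemb g * (1 - gemb (ore_elt D)));
  ore_basis : is_basis (fun gi : G * nat => gemb gi.1 * ore_var ^+ gi.2);
  comul_gemb : forall g : G, comul ore_hopf (gemb g) = gemb g ⊗ gemb g;
  counit_gemb : forall g : G, counit ore_hopf (gemb g) = 1;
  antipode_gemb : forall g : G, antipode ore_hopf (gemb g) = gemb g^-1%g;
  comul_ore_var :
    comul ore_hopf ore_var = ore_var ⊗ gemb (ore_elt D) + 1 ⊗ ore_var;
  counit_ore_var : counit ore_hopf ore_var = 0;
  antipode_ore_var :
    antipode ore_hopf ore_var = - (ore_var * gemb (ore_elt D)^-1%g)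
}.

Section HopfOreExtensionTheory.
Variables (k : fieldType) (G : groupType) (D : hopfOreDatum k G).
Variable H : hopfOreExtension D.

Definition group_algebra : set H := lspan (range (gemb H)).

(* If chi(a) = 1 and alpha(a) = 0, ore_rel already gives a^-1 x a = x. *)
Definition normalized : Prop :=
  let a := ore_elt D in let x := ore_var H in
  (ore_char D a != 1 -> forall g, ore_cocycle D g = 0) /\
  (ore_char D a = 1 -> ore_cocycle D a != 0 ->
     gemb H a^-1%g * x * gemb H a = x + (1 - gemb H a)).

(* A x^n *)
Definition times_var (A : set H) (n : nat) : set H :=
  [set h * ore_var H ^+ n | h in A].

End HopfOreExtensionTheory.

Arguments group_algebra {k G D} H.
Arguments normalized {k G D} H.
Arguments times_var {k G D H} A n.

(* Main.v *)
From HB Require Import structures.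
Require Import Defs.
From mathcomp Require Import all_boot all_order all_algebra.
From mathcomp Require Import ring.
From mathcomp Require Import boolp classical_sets.

Set Implicit Arguments.
Unset Strict Implicit.
Unset Printing Implicit Defensive.

Import GRing.Theory.

Local Open Scope classical_set_scope.
Local Open Scope ring_scope.

(** Every power of x has a coproduct of the form
    [Delta(x^n) = sum_s x^s (x) w(n,s)], where [w(n,s)] is the sum of all words
    with [s] letters [a] and [n - s] letters [x] (lemma [comul_expr]).  Let
    [pi_t] be the left [kG]-linear map that reads off the coefficient of [x^t].
    Moving [x] past [kG] costs a twist [g |-> chi(g) g] and a skew derivation
    [g |-> alpha(g) g (1 - a)].  The normalization makes these two commute up to
    [q], and then the q-binomial theorem gives, up to a power of [q],
        [pi_t (w(n,s)) = [n choose t]_q pi_0 (w(n-t,s))]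
    (lemma [coefx_comul_coef]); here [pi_0 (w(m,s))] is [a^m] for [m = s] and
    vanishes for [m < s].  The Gaussian binomials enter as the coefficients of
    the product [gauss q n] of the factors [1 + q^i X], [i < n].

    The coradical is [kG]: if a subcoalgebra contains an element of degree [n]
    in [x], applying to the left tensor factor of its coproduct a functional
    that picks a monomial [g x^n] leaves a nonzero multiple of the grouplike
    element [g a^n] (lemma [subcoalgebra_grouplike]).

    An element of [H_1] has a coproduct without terms [g x^s (x) h x^t] with
    [s, t > 0].  For an element with leading term [c x^n], the terms with
    [s + t = n] are [[n choose t]_q Delta(c) (1 (x) a^s)] up to a unit, and
    [Delta(c) (1 (x) a^s)] is nonzero.  Hence [H_1] is the sum of the [H_0 x^n]
    over those [n] for which all [[n choose t]_q] with [0 < t < n] vanish, called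
    primitive degrees below (lemmas [filtration1_term], [filtration1_coefx]).
    When [q = 1] and [x] does not commute with [a], terms of lower total degree
    appear as well, but the formula for [pi_t (w(n,s))] shows that they carry the
    same binomial factors.

    It remains to find the primitive degrees.  For [n > 1] the vanishing of
    [[n choose 1]_q] forces [q^n = 1].  If [q] is a primitive [N]-th root of
    unity, [gauss q (N m)] equals [(1 + c X^N)^m] with [c <> 0]; so the primitive
    degrees above 1 are [N] alone in characteristic 0 and the [N p^r] in
    characteristic [p].  Finally [k (x)_{H_0} H_1] has the classes of the [x^n],
    [n] a primitive degree, as a basis, which gives the rank. *)

(** * Gaussian binomial coefficients at a root of unity *)

Section GaussPolynomials.
Variables (k : fieldType) (q : k).

(** By Gauss's formula the coefficient of [X^t] is [q^(t(t-1)/2)] times the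
    Gaussian binomial [[n choose t]_q]; for [q] nonzero the two vanish together,
    and the product is easier to evaluate at a root of unity. *)
Definition gauss (n : nat) : {poly k} := \prod_(i < n) (1 + q ^+ i *: 'X).

Lemma gauss0 : gauss 0 = 1. Proof. by rewrite /gauss big_ord0. Qed.

Lemma gaussS n : gauss n.+1 = gauss n * (1 + q ^+ n *: 'X).
Proof. by rewrite /gauss big_ord_recr. Qed.

Lemma coef_gaussS n t :
  (gauss n.+1)`_t =
  (gauss n)`_t + q ^+ n * (if t is t'.+1 then (gauss n)`_t' else 0).
Proof.
rewrite gaussS mulrDr mulr1 -scalerAr coefD coefZ coefMX.
by case: t => [|t].
Qed.

Lemma gauss_coef0 n : (gauss n)`_0 = 1.
Proof.
by elim: n => [|n IH]; rewrite ?gauss0 ?coef1 // coef_gaussS mulr0 addr0.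
Qed.

Lemma gauss_coef_gt n t : (n < t)%N -> (gauss n)`_t = 0.
Proof.
elim: n t => [|n IH] [|t] //; first by rewrite gauss0 coef1.
by move=> lt_nt; rewrite coef_gaussS !IH ?mulr0 ?addr0 // ltnW.
Qed.

Lemma gauss_coef1 n : (gauss n)`_1 = \sum_(i < n) q ^+ i.
Proof.
elim: n => [|n IH]; first by rewrite gauss0 coef1 big_ord0.
by rewrite coef_gaussS IH gauss_coef0 mulr1 big_ord_recr.
Qed.

Lemma gauss_coefn n : q != 0 -> (gauss n)`_n != 0.
Proof.
move=> q0; elim: n => [|n IH]; first by rewrite gauss_coef0 oner_neq0.
by rewrite coef_gaussS gauss_coef_gt // add0r mulf_neq0 // expf_neq0.
Qed.

(** The other Pascal rule: it amounts to peeling off the factor [1 + X] first,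
    the remaining factors being [gauss n] at [q X]. *)
Lemma gauss_pascal n t :
  (gauss n.+1)`_t = q ^+ t * (gauss n)`_t
                    + (if t is t'.+1 then q ^+ t' * (gauss n)`_t' else 0).
Proof.
elim: n t => [|n IH] t.
  rewrite coef_gaussS gauss0; case: t => [|[|t]];
    rewrite !coef1 /= ?mulr0n ?mulr1n ?expr0 ?expr1 ?expr1n; ring.
rewrite [LHS]coef_gaussS [in LHS]IH.
case: t => [|[|t]]; rewrite ?[in LHS]IH ?[in RHS]coef_gaussS ?exprS; ring.
Qed.

(** For [q] nonzero and [n > 0] this says that [(A + B)^n = A^n + B^n] follows
    from [B A = q A B]; in the Hopf-Ore extension such [n] are the exponents of
    the powers of the variable in the first term of the coradical filtration. *)
Definition primitive_degree (n : nat) : Prop :=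
  forall t, (0 < t < n)%N -> (gauss n)`_t = 0.

Lemma primitive_degree_le1 n : (n <= 1)%N -> primitive_degree n.
Proof. by move=> n1 t /andP[t0 /leq_trans/(_ n1)]; rewrite ltnS leqNgt t0. Qed.

(** The coefficient of [X] is [1 + q + ... + q^(n-1)], and it divides
    [q^n - 1]. *)
Lemma primitive_degree_root n : (1 < n)%N -> primitive_degree n ->
  exists2 N, N.-primitive_root q & (N %| n)%N.
Proof.
move=> n1 /(_ 1%N n1); rewrite gauss_coef1 => sum0.
have qn : q ^+ n = 1 by apply/eqP; rewrite -subr_eq0 subrX1 sum0 mulr0.
by have [N ? ?] := prim_order_exists (ltnW n1) qn; exists N.
Qed.

Variable N : nat.
Hypothesis primq : N.-primitive_root q.

Let N_gt0 : (0 < N)%N := prim_order_gt0 primq.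
Let q_neq0 : q != 0.
Proof. by rewrite (prim_root_eq0 primq) -lt0n. Qed.

(** Because [q^N = 1], dropping the first factor or the last one from
    [gauss N.+1] shows that [gauss N] is unchanged when [X] is replaced by
    [q X].  So only exponents divisible by [N] occur. *)
Lemma gauss_prim : exists2 c : k, c != 0 & gauss N = 1 + c *: 'X^N.
Proof.
(* Comparing the two Pascal rules at n = N, where q ^+ N = 1. *)
have coef0 t : (1 - q ^+ t) * (gauss N)`_t = 0.
  elim: t => [|t IH]; first by rewrite expr0 subrr mul0r.
  have := gauss_pascal N t.+1; rewrite coef_gaussS (prim_expr_order primq) => E.
  move: IH; rewrite mulrBl mul1r => /subr0_eq IH.
  rewrite mulrBl mul1r; apply/eqP; rewrite subr_eq0; apply/eqP.
  by apply: (addIr (1 * (gauss N)`_t)); rewrite E -IH mul1r.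
exists (gauss N)`_N; first exact: gauss_coefn.
apply/polyP => t; rewrite coefD coefZ coef1 coefXn.
have [->|t0] := eqVneq t 0%N.
  by rewrite gauss_coef0 eq_sym (gtn_eqF N_gt0) mulr0 addr0.
have [->|tN] := eqVneq t N; first by rewrite add0r mulr1.
rewrite mulr0 addr0; case: (ltngtP t N) tN => // [ltN _|gtN _]; last first.
  exact: gauss_coef_gt.
have /eqP := coef0 t; rewrite mulf_eq0 subr_eq0 eq_sym -(prim_order_dvd primq).
by rewrite gtnNdvd ?lt0n // => /eqP.
Qed.

(** The factors of [gauss (N m)] repeat with period [N]. *)
Lemma gauss_prim_mul : exists2 c : k, c != 0 &
  forall m, gauss (N * m) = (1 + c *: 'X^N) ^+ m.
Proof.
have [c c0 gN] := gauss_prim; exists c => // m.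
elim: m => [|m IH]; first by rewrite muln0 gauss0.
rewrite exprSr -IH -gN mulnSr /gauss big_split_ord; congr (_ * _).
by apply: eq_bigr => i _; rewrite exprD exprM (prim_expr_order primq) expr1n mul1r.
Qed.

Lemma coef_binomX (c : k) d m : (0 < d)%N -> ((1 + c *: 'X^d) ^+ m)`_d = c *+ m.
Proof.
move=> d0; elim: m => [|m IH]; first by rewrite expr0 coef1 (gtn_eqF d0).
have coef0 : ((1 + c *: 'X^d) ^+ m)`_0 = 1.
  rewrite -horner_coef0 horner_exp hornerD hornerZ hornerXn hornerC.
  by rewrite expr0n (gtn_eqF d0) mulr0 addr0 expr1n.
rewrite exprSr mulrDr mulr1 -scalerAr coefD coefZ IH coefMXn ltnn subnn coef0.
by rewrite mulr1 mulrSr.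
Qed.

Lemma primitive_degree_pchar0 n : [pchar k] =i pred0 -> (1 < n)%N ->
  (N %| n)%N -> primitive_degree n -> n = N.
Proof.
move=> ch0 n1 /dvdnP[m nE] pn; rewrite mulnC in nE.
case: m nE => [|[|m]] nE; rewrite ?muln1 // in nE; first by rewrite nE muln0 in n1.
have [c c0 gE] := gauss_prim_mul.
have := pn N; rewrite nE gE coef_binomX // -mulr_natr => /(_ _)/eqP.
rewrite mulf_eq0 (negPf c0) (pcharf0P k).1 // N_gt0 ltn_Pmulr //.
by move/(_ isT).
Qed.

Section PositiveCharacteristic.
Variable p : nat.
Hypothesis chp : p \in [pchar k].

(** The Frobenius map turns [(1 + c X^N)^(p^r)] into a binomial again. *)
Lemma gauss_prim_pchar r : exists2 c : k, c != 0 &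
  forall m, gauss (N * p ^ r * m) = (1 + c *: 'X^(N * p ^ r)) ^+ m.
Proof.
have [c c0 gE] := gauss_prim_mul; exists (c ^+ (p ^ r)); first exact: expf_neq0.
move=> m; rewrite -mulnA gE exprM exprDn_pchar.
  by rewrite expr1n exprZn -exprM.
rewrite (eq_pnat _ (pchar_poly _)) pnatX pnatE ?chp //.
exact: pcharf_prime chp.
Qed.

(** Writing [n = N p^r m] with [m] prime to [p], the coefficient of [X^(N p^r)]
    in [gauss n] is a nonzero multiple of [m], so [m] must be 1. *)
Lemma primitive_degree_pcharP n : (1 < n)%N -> (N %| n)%N ->
  primitive_degree n -> exists r, n = (N * p ^ r)%N.
Proof.
move=> n1 /dvdnP[m nE] pn; rewrite mulnC in nE.
have m0 : (0 < m)%N by rewrite lt0n; apply: contraTneq n1 => m0; rewrite nE m0 muln0.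
have p_pr := pcharf_prime chp.
have [m' pm' mE] := pfactor_coprime p_pr m0.
set r := logn p m in mE; exists r.
rewrite mE [(m' * _)%N]mulnC mulnA in nE; rewrite nE.
case: m' pm' mE nE => [|[|m']] pm' mE nE; first by rewrite nE muln0 in n1.
  exact: muln1.
have [c c0 gE] := gauss_prim_pchar r.
have Npr_gt0 : (0 < N * p ^ r)%N by rewrite muln_gt0 N_gt0 expn_gt0 prime_gt0.
have := pn (N * p ^ r)%N; rewrite nE gE coef_binomX // -mulr_natr => /(_ _)/eqP.
rewrite mulf_eq0 (negPf c0) -(dvdn_pcharf chp) Npr_gt0 ltn_Pmulr //=.
by move/(_ isT); move: pm'; rewrite prime_coprime // => /negPf->.
Qed.

Lemma primitive_degree_pchar r : primitive_degree (N * p ^ r).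
Proof.
move=> t /andP[t0 tn]; have [c _ /(_ 1%N)] := gauss_prim_pchar r.
rewrite muln1 expr1 => ->; rewrite coefD coefZ coefXn coef1.
by rewrite (gtn_eqF t0) (ltn_eqF tn) mulr0 addr0.
Qed.

End PositiveCharacteristic.

Lemma primitive_degree_order : primitive_degree N.
Proof.
move=> t /andP[t0 tn]; have [c _ ->] := gauss_prim.
rewrite coefD coefZ coefXn coef1.
by rewrite (gtn_eqF t0) (ltn_eqF tn) mulr0 addr0.
Qed.

End GaussPolynomials.

(** * Subspaces, spans and linear extension *)

Section Spans.
Variable k : fieldType.
Implicit Types U V W : lmodType k.

Lemma subspaceP V (A : set V) :
  subspace A <-> A 0 /\ forall c u v, A u -> A v -> A (c *: u + v).
Proof.
split=> [[A0 AD]|[A0 AD]]; first split.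
- by move: A0; rewrite inE.
- by move=> c u v Au Av; have := AD c u v; rewrite !inE => /(_ Au Av).
- by split; rewrite ?inE // => c u v; rewrite !inE; apply: AD.
Qed.

Section Closure.
Variables (V : lmodType k) (A : set V).
Hypothesis sA : subspace A.

Lemma subspace0 : A 0. Proof. by have /subspaceP[] := sA. Qed.

Lemma subspaceZ c u : A u -> A (c *: u).
Proof.
by have /subspaceP[A0 AD] := sA => /AD/(_ A0); move/(_ c); rewrite addr0.
Qed.

Lemma subspaceD u v : A u -> A v -> A (u + v).
Proof.
by have /subspaceP[_ AD] := sA => Au /(AD 1 _ _ Au); rewrite scale1r.
Qed.

Lemma subspaceB u v : A u -> A v -> A (u - v).
Proof. by move=> Au Av; rewrite -scaleN1r; apply/subspaceD/subspaceZ. Qed.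

Lemma subspace_sum (I : Type) (s : seq I) (P : pred I) (F : I -> V) :
  (forall i, P i -> A (F i)) -> A (\sum_(i <- s | P i) F i).
Proof. exact: (big_ind A subspace0 subspaceD). Qed.

End Closure.

Lemma subspace_bigcap V (C : set (set V)) :
  (forall A, C A -> subspace A) -> subspace (\bigcap_(A in C) A).
Proof.
move=> sC; apply/subspaceP; split=> [A CA|c u v Iu Iv A CA].
  exact: subspace0 (sC _ CA).
have sA := sC _ CA; apply: (subspaceD sA); last exact: Iv.
by apply: (subspaceZ sA); exact: Iu.
Qed.

Lemma lspan_subspace V (A : set V) : subspace (lspan A).
Proof. by apply: subspace_bigcap => B []. Qed.

Lemma sub_lspan V (A : set V) : A `<=` lspan A.
Proof. exact: sub_gen_smallest. Qed.

Lemma lspan_min V (A B : set V) : subspace B -> A `<=` B -> lspan A `<=` B.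
Proof. exact: smallest_sub. Qed.

Lemma lspan_mono V (A B : set V) : A `<=` B -> lspan A `<=` lspan B.
Proof.
by move=> AB; apply: lspan_min; [exact: lspan_subspace|move=> u /AB; apply: sub_lspan].
Qed.

Lemma subspace_preim V W (f : V -> W) (B : set W) :
  linear f -> subspace B -> subspace (f @^-1` B).
Proof.
move=> lf /subspaceP[B0 BD]; apply/subspaceP; split=> [|c u v Bu Bv] /=.
  by have := lf (-1) 0 0; rewrite scaler0 addr0 scaleN1r addNr => ->.
by rewrite lf; apply: BD.
Qed.

Lemma subspace_eq V W (f g : V -> W) :
  linear f -> linear g -> subspace [set u | f u = g u].
Proof.
move=> lf lg; apply/subspaceP; split=> [|c u v fgu fgv] /=.
  have l0 (h : V -> W) : linear h -> h 0 = 0.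
    by move=> lh; have := lh (-1) 0 0; rewrite scaler0 addr0 scaleN1r addNr.
  by rewrite !l0.
by rewrite lf lg fgu fgv.
Qed.

Lemma linear_funB V W (f : V -> W) u v : linear f -> f (u - v) = f u - f v.
Proof. by move=> lf; rewrite addrC -!scaleN1r lf scaleN1r addrC. Qed.

Lemma linear_funZ V W (f : V -> W) c u : linear f -> f (c *: u) = c *: f u.
Proof.
move=> lf; have f0 : f 0 = 0 by rewrite -[X in f X](subrr 0) linear_funB // subrr.
by have := lf c u 0; rewrite f0 !addr0.
Qed.

Lemma linear_fun_sum V W (f : V -> W) (I : Type) (s : seq I) (F : I -> V) :
  linear f -> f (\sum_(i <- s) F i) = \sum_(i <- s) f (F i).
Proof.
move=> lf; apply: (big_morph f); last first.
  by have := lf (-1) 0 0; rewrite scaler0 addr0 scaleN1r addNr.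
by move=> u v; have := lf 1 u v; rewrite !scale1r.
Qed.

Lemma linear_scale V W (f : V -> W) c : linear f -> linear (fun u => c *: f u).
Proof. by move=> lf d u v; rewrite lf scalerDr !scalerA mulrC. Qed.

Lemma linear_comp U V W (f : V -> W) (g : U -> V) :
  linear f -> linear g -> linear (f \o g).
Proof. by move=> lf lg c u v; rewrite /= lg lf. Qed.

Lemma add_sub_subspace V (A B : set V) :
  subspace A -> subspace B -> subspace (add_sub A B).
Proof.
move=> sA sB; apply/subspaceP; split.
  by exists 0; [exact: subspace0|exists 0; [exact: subspace0|rewrite addr0]].
move=> c _ _ [u Au [v Bv <-]] [u' Au' [v' Bv' <-]].
exists (c *: u + u'); first exact/(subspaceD sA)/Au'/(subspaceZ sA).
exists (c *: v + v'); first exact/(subspaceD sB)/Bv'/(subspaceZ sB).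
by rewrite scalerDr addrACA.
Qed.

Lemma lspan_rangeP V (I : eqType) (h : I -> V) u : lspan (range h) u ->
  exists s c, uniq s /\ u = \sum_(i <- s) c i *: h i.
Proof.
move: u; apply: lspan_min; last first.
  move=> _ [i _ <-]; exists [:: i], (fun=> 1); split=> //.
  by rewrite big_seq1 scale1r.
apply/subspaceP; split; first by exists [::], (fun=> 0); rewrite big_nil.
move=> e _ _ [s [c [us ->]]] [t [d [ut ->]]].
pose r := undup (s ++ t).
have ext (s' : seq I) (c' : I -> k) : uniq s' -> {subset s' <= r} ->
    \sum_(i <- s') c' i *: h i = \sum_(i <- r) (if i \in s' then c' i else 0) *: h i.
  move=> us' s'r; transitivity (\sum_(i <- r | i \in s') c' i *: h i).
    rewrite -[RHS]big_filter; apply: perm_big; apply: uniq_perm => //.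
      by rewrite filter_uniq // undup_uniq.
    move=> i; rewrite mem_filter; case: (boolP (i \in s')) => //= /s'r.
    by move=> ->.
  rewrite big_mkcond; apply: eq_bigr => i _.
  by case: ifP; rewrite // scale0r.
exists r, (fun i => e * (if i \in s then c i else 0) + (if i \in t then d i else 0)).
split; first exact: undup_uniq.
rewrite (ext s) // ?(ext t) //; last 2 first.
- by move=> i it; rewrite mem_undup mem_cat it orbT.
- by move=> i it; rewrite mem_undup mem_cat it.
rewrite scaler_sumr -big_split; apply: eq_bigr => i _ /=.
by rewrite scalerA scalerDl.
Qed.

(** The graph of the extension is the span of the pairs [(b i, F i)]: it projects
    onto [V] because [b] spans, and it is single-valued because [b] is
    independent. *)
Lemma linear_extension V W (I : eqType) (b : I -> V) (F : I -> W) :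
  is_basis b -> exists f : {linear V -> W}, forall i, f (b i) = F i.
Proof.
move=> [indb spanb]; pose R := lspan (range (fun i => (b i, F i))).
have sR : subspace R by exact: lspan_subspace.
have total v : exists w, R (v, w).
  have : lspan (range b) v by rewrite spanb.
  move: v; apply: lspan_min; last first.
    by move=> _ [i _ <-]; exists (F i); apply: sub_lspan; exists i.
  apply/subspaceP; split; first by exists 0; exact: (subspace0 sR).
  move=> c u v [u' Ru] [v' Rv]; exists (c *: u' + v').
  exact: (subspaceD sR (subspaceZ sR c Ru) Rv).
have fun0 w : R (0, w) -> w = 0.
  move=> /lspan_rangeP[s [c [us E]]].
  have Eb : \sum_(i <- s) c i *: b i = 0.
    by rewrite -[RHS]/((0 : V, w).1) E raddf_sum.
  rewrite -[w]/((0 : V, w).2) E raddf_sum /= big_seq big1 // => i si.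
  by rewrite (indb s c us Eb) // scale0r.
have func v w w' : R (v, w) -> R (v, w') -> w = w'.
  move=> Rw Rw'; apply/eqP; rewrite -subr_eq0; apply/eqP/fun0.
  rewrite -(subrr v); exact: (subspaceB sR Rw Rw').
pose f v := projT1 (cid (total v)).
have fP v : R (v, f v) := projT2 (cid (total v)).
have lf : linear f.
  move=> c u v; apply: (func _ _ _ (fP _)).
  exact: (subspaceD sR (subspaceZ sR c (fP u)) (fP v)).
exists (HB.pack_for {linear V -> W} f (GRing.isLinear.Build k V W *:%R f lf)).
by move=> i /=; apply: (func _ _ _ (fP _)); apply: sub_lspan; exists i.
Qed.

End Spans.

(** * Linear maps on tensor products *)

Section Tensors.
Variable k : fieldType.
Implicit Types U V W : lmodType k.

Lemma tmap_bilinear V V' W W' (f : V -> V') (g : W -> W') :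
  linear f -> linear g ->
  bilinear_map (fun v w => tens (f v) (g w) : tensor V' W').
Proof.
move=> lf lg; have [tl tr] := @tens_bilinear k V' W'.
by split=> [w c u v|v c u w] /=; [rewrite lf; apply: tl|rewrite lg; apply: tr].
Qed.

Lemma tmap_linear V V' W W' (f : V -> V') (g : W -> W') :
  linear f -> linear g -> linear (tmap f g : tensor V W -> tensor V' W').
Proof. by move=> lf lg; apply/tlift_linear/tmap_bilinear. Qed.

Lemma tmapE V V' W W' (f : V -> V') (g : W -> W') v w :
  linear f -> linear g -> tmap f g (v ⊗ w) = f v ⊗ g w.
Proof. by move=> lf lg; rewrite /tmap tliftE //; apply: tmap_bilinear. Qed.

Lemma slice_bilinear V W (f : V -> k^o) : linear f ->
  bilinear_map (fun (v : V) (w : W) => f v *: w).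
Proof.
move=> lf; split=> [w c u v|v c u w] /=; first by rewrite lf scalerDl scalerA.
by rewrite scalerDr !scalerA mulrC.
Qed.

Lemma tens0l V W (w : W) : (0 : V) ⊗ w = 0.
Proof. by rewrite (bilinear_map0l _ (@tens_bilinear k V W)). Qed.

Lemma tensDr V W (v : V) (u w : W) : v ⊗ (u + w) = v ⊗ u + v ⊗ w.
Proof.
by have := (@tens_bilinear k V W).2 v 1 u w; rewrite /= !scale1r.
Qed.

Lemma tensZl V W c (v : V) (w : W) : (c *: v) ⊗ w = c *: (v ⊗ w).
Proof. exact: bilinear_mapZl (@tens_bilinear k V W). Qed.

Lemma tens0r V W (v : V) : v ⊗ (0 : W) = 0.
Proof.
by have := (@tens_bilinear k V W).2 v (-1) 0 0;
  rewrite /= !scaleN1r addNr addNr.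
Qed.

Lemma tensZr V W c (v : V) (w : W) : v ⊗ (c *: w) = c *: (v ⊗ w).
Proof.
by have := (@tens_bilinear k V W).2 v c w 0; rewrite /= tens0r !addr0.
Qed.

Lemma slice_tensor_sub V W (f : V -> k^o) (A : set V) (B : set W) t :
  linear f -> subspace B -> tensor_sub A B t -> B (tlift (fun v w => f v *: w) t).
Proof.
move=> lf sB; have bf := slice_bilinear W lf; move: t; apply: lspan_min.
  exact: subspace_preim (tlift_linear bf) sB.
by move=> _ [v _ [w Bw <-]] /=; rewrite tliftE //; apply: subspaceZ.
Qed.

Lemma tens_mulr (A B : algType k) (a : A) (b : B) (t : tensor A B) :
  t * (a ⊗ b) = tmap ( *%R^~ a) ( *%R^~ b) t.
Proof.
apply: eq_tlift => c d; rewrite tliftE //.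
exact: tmul_bilinear_in (@tens_bilinear k A B).
Qed.

Lemma mulrr_linear (A : algType k) (a : A) : linear ( *%R^~ a).
Proof. by move=> c u v; rewrite mulrDl scalerAl. Qed.

Lemma tens_mulr_linear (A B : algType k) (a : A) (b : B) :
  linear (fun t : tensor A B => t * (a ⊗ b)).
Proof.
move=> c t u; rewrite !tens_mulr.
by apply: tmap_linear; apply: mulrr_linear.
Qed.

End Tensors.

(** * Coefficients of the powers of the variable *)

Section HopfOre.
Variables (k : fieldType) (G : groupType) (D : hopfOreDatum k G).
Variable H : hopfOreExtension D.

Local Notation e := (gemb H).
Local Notation x := (ore_var H).
Local Notation a := (gemb H (ore_elt D)).
Local Notation q := (ore_char D (ore_elt D)).
Local Notation chi := (ore_char D).
Local Notation alpha := (ore_cocycle D).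
Local Notation kG := (group_algebra H).

Lemma monomial_linear (W : lmodType k) (F : G * nat -> W) :
  {f : {linear H -> W} | forall g i, f (e g * x ^+ i) = F (g, i)}.
Proof.
apply: cid; have [f fE] := linear_extension F (ore_basis H).
by exists f => g i; exact: (fE (g, i)).
Qed.

Lemma group_algebra_subspace : subspace kG.
Proof. exact: lspan_subspace. Qed.
Local Notation skG := group_algebra_subspace.

Lemma group_algebra_gemb g : kG (e g). Proof. by apply: sub_lspan; exists g. Qed.

Lemma group_algebraP (A : set H) : subspace A -> (forall g, A (e g)) -> kG `<=` A.
Proof. by move=> sA Ag; apply: lspan_min => // _ [g _ <-]. Qed.

Lemma group_algebra1 : kG 1.
Proof. by rewrite -(gemb1 H); apply: group_algebra_gemb. Qed.

Lemma group_algebraM u v : kG u -> kG v -> kG (u * v).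
Proof.
move=> Gu Gv; move: v Gv u Gu; apply: group_algebraP => [|h].
  apply/subspaceP; split=> [u _|c v w Gv Gw u Gu].
    by rewrite mulr0; apply: subspace0 skG.
  rewrite mulrDr -scalerAr; apply: (subspaceD skG); last exact: Gw.
  by apply: (subspaceZ skG); apply: Gv.
apply: group_algebraP => [|g]; last by rewrite -gembM; apply: group_algebra_gemb.
exact: subspace_preim (mulrr_linear _) skG.
Qed.

(** The part of degree less than [d] in the variable; as a span of monomials it
    lets linear identities be checked on monomials of bounded degree. *)
Definition degree_lt (d : nat) : set H :=
  lspan [set u | exists g i, (i < d)%N /\ u = e g * x ^+ i].

Lemma degree_lt_subspace d : subspace (degree_lt d).
Proof. exact: lspan_subspace. Qed.

Lemma degree_ltP d (A : set H) : subspace A ->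
  (forall g i, (i < d)%N -> A (e g * x ^+ i)) -> degree_lt d `<=` A.
Proof. by move=> sA Ag; apply: lspan_min => // _ [g [i [id ->]]]; apply: Ag. Qed.

Lemma degree_lt_mono d d' : (d <= d')%N -> degree_lt d `<=` degree_lt d'.
Proof.
move=> dd'; apply: lspan_mono => _ [g [i [id ->]]].
by exists g, i; split; first exact: leq_trans dd'.
Qed.

Lemma monomial_ind (A : set H) : subspace A ->
  (forall g i, A (e g * x ^+ i)) -> forall u, A u.
Proof.
move=> sA Ag u; have [_ spanb] := ore_basis H.
have : lspan (range (fun gi : G * nat => e gi.1 * x ^+ gi.2)) u by rewrite spanb.
by move: u; apply: lspan_min => // _ [[g i] _ <-]; apply: Ag.
Qed.

Lemma degree_ltT u : exists d, degree_lt d u.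
Proof.
move: u; apply: monomial_ind => [|g i]; last first.
  by exists i.+1; apply: sub_lspan; exists g, i.
apply/subspaceP; split; first by exists 0%N; apply: subspace0 (degree_lt_subspace _).
move=> c u v [d du] [d' dv]; exists (maxn d d').
apply: (subspaceD (degree_lt_subspace _)); last first.
  exact: degree_lt_mono (leq_maxr _ _) _ dv.
apply: (subspaceZ (degree_lt_subspace _)).
exact: degree_lt_mono (leq_maxl _ _) _ du.
Qed.

(** The coefficient of [x^i] when [kG] is written on the left of the powers. *)
Definition coefx (i : nat) : {linear H -> H} :=
  sval (monomial_linear (fun gj => if gj.2 == i then e gj.1 else 0)).

Lemma coefx_monomial i g j : coefx i (e g * x ^+ j) = if j == i then e g else 0.
Proof. exact: (svalP (monomial_linear _)). Qed.

Lemma coefx_in i u : kG (coefx i u).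
Proof.
move: u; apply: monomial_ind => [|g j].
  exact: subspace_preim (linearP (coefx i)) skG.
rewrite coefx_monomial; case: eqP => _; first exact: group_algebra_gemb.
exact: subspace0 skG.
Qed.

Lemma coefxMl i h u : kG h -> coefx i (h * u) = h * coefx i u.
Proof.
move=> Gh; move: h Gh u; apply: group_algebraP => [|g].
  apply/subspaceP; split=> [u|c v w Gv Gw u]; first by rewrite !mul0r linear0.
  by rewrite !mulrDl -!scalerAl linearP Gv Gw.
apply: monomial_ind => [|h j].
  apply: subspace_eq => c u v.
    by rewrite mulrDr -scalerAr linearP.
  by rewrite linearP mulrDr -scalerAr.
rewrite mulrA -gembM !coefx_monomial; case: eqP; rewrite ?mulr0 //.
by rewrite gembM.
Qed.

Lemma coefx_expr i j : coefx i (x ^+ j) = (j == i)%:R.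
Proof. by rewrite -[x ^+ j]mul1r -(gemb1 H) coefx_monomial gemb1; case: eqP. Qed.

Lemma coefx_term i h j : kG h -> coefx i (h * x ^+ j) = if j == i then h else 0.
Proof.
by move=> Gh; rewrite coefxMl // coefx_expr; case: eqP; rewrite (mulr0, mulr1).
Qed.

Lemma coefx_expansion d u : degree_lt d u -> u = \sum_(i < d) coefx i u * x ^+ i.
Proof.
move: u; apply: degree_ltP => [|g j jd].
  apply: (@subspace_eq _ _ _ id) => // c u v; rewrite scaler_sumr -big_split.
  by apply: eq_bigr => i _; rewrite linearP mulrDl scalerAl.
rewrite (bigD1 (Ordinal jd)) //= coefx_monomial eqxx big1 ?addr0 // => i ij.
rewrite coefx_monomial ifN ?mul0r //.
by apply: contraNneq ij => ji; apply/eqP/val_inj.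
Qed.

Lemma degree_lt_term d h i : kG h -> (i < d)%N -> degree_lt d (h * x ^+ i).
Proof.
move=> Gh id; move: h Gh; apply: group_algebraP => [|g].
  exact: subspace_preim (mulrr_linear _) (degree_lt_subspace _).
by apply: sub_lspan; exists g, i.
Qed.

Lemma coefx_degree_lt d u i : degree_lt d u -> (d <= i)%N -> coefx i u = 0.
Proof.
move=> du di; move: u du; apply: degree_ltP => [|g j jd].
  exact: subspace_eq (linearP _) (linearP (\0 : {linear H -> H})).
by rewrite coefx_monomial ltn_eqF // (leq_trans jd).
Qed.

Lemma degree_lt_drop d u :
  degree_lt d.+1 u -> degree_lt d (u - coefx d u * x ^+ d).
Proof.
move=> du; rewrite {1}(coefx_expansion du) big_ord_recr /= addrK.
apply: (subspace_sum (degree_lt_subspace d)) => i _.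
by apply: degree_lt_term => //; exact: coefx_in.
Qed.

Lemma coefx_group_algebra u : (forall i, (0 < i)%N -> coefx i u = 0) -> kG u.
Proof.
move=> u0; have [d du] := degree_ltT u; rewrite (coefx_expansion du).
apply: (subspace_sum skG) => [[[|i] id]] _ /=.
  by rewrite mulr1; apply: coefx_in.
by rewrite u0 // mul0r; apply: subspace0 skG.
Qed.

(** On [kG] the defining relation reads [x h = twist h x + skew h]. *)
Definition twist : {linear H -> H} :=
  sval (monomial_linear (fun gj => chi gj.1 *: e gj.1)).
Definition skew : {linear H -> H} :=
  sval (monomial_linear (fun gj => alpha gj.1 *: (e gj.1 * (1 - a)))).

Lemma twist_monomial g j : twist (e g * x ^+ j) = chi g *: e g.
Proof. exact: (svalP (monomial_linear _)). Qed.

Lemma skew_monomial g j : skew (e g * x ^+ j) = alpha g *: (e g * (1 - a)).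
Proof. exact: (svalP (monomial_linear _)). Qed.

Lemma twist_gemb g : twist (e g) = chi g *: e g.
Proof. by rewrite -[e g]mulr1 -[1](expr0 x) twist_monomial mulr1. Qed.

Lemma skew_gemb g : skew (e g) = alpha g *: (e g * (1 - a)).
Proof. by rewrite -[X in skew X]mulr1 -[1](expr0 x) skew_monomial. Qed.

(** The defining relation moves [x] past the coefficients of [u]. *)
Lemma coefx_varM i u :
  coefx i (x * u) = (if i is j.+1 then twist (coefx j u) else 0) + skew (coefx i u).
Proof.
move: u; apply: monomial_ind => [|g j].
  apply: subspace_eq => c u v; first by rewrite mulrDr -scalerAr linearP.
  case: i => [|i]; rewrite !linearP; first by rewrite !add0r.
  by rewrite scalerDr addrACA.
rewrite mulrA ore_rel mulrDl -!scalerAl -mulrA -exprS linearD !linearZ /=.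
rewrite !coefx_monomial coefx_term; last first.
  apply: group_algebraM; first exact: group_algebra_gemb.
  exact: (subspaceB skG group_algebra1 (group_algebra_gemb _)).
congr (_ + _); last by case: eqP => _; rewrite ?skew_gemb ?scaler0 ?linear0.
case: i => [|i]; first by rewrite scaler0.
rewrite coefx_monomial eqSS; case: eqP => _; first by rewrite twist_gemb.
by rewrite scaler0 linear0.
Qed.

Lemma chi_neq0 g : chi g != 0.
Proof.
apply/eqP => g0; have := ore_char1 D; rewrite -(mulgV g) ore_charM g0 mul0r.
by move/eqP; rewrite eq_sym oner_eq0.
Qed.

Lemma twist_ore_elt u : twist (a * u) = q *: (a * twist u).
Proof.
move: u; apply: monomial_ind => [|g j].
  apply: subspace_eq => c u v; first by rewrite mulrDr -scalerAr linearP.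
  by rewrite linearP mulrDr -scalerAr scalerDr !scalerA mulrC.
by rewrite mulrA -gembM !twist_monomial ore_charM -scalerAr scalerA gembM.
Qed.

(** * The coproduct of a power of the variable *)

(** The sum of all words with [s] letters [a] and [n - s] letters [x], built by
    their first letter. *)
Fixpoint comul_coef (n s : nat) : H :=
  if n is n'.+1 then
    x * comul_coef n' s + (if s is s'.+1 then a * comul_coef n' s' else 0)
  else (s == 0%N)%:R.
Local Notation w := comul_coef.

Lemma comul_coef_gt n s : (n < s)%N -> w n s = 0.
Proof.
elim: n s => [|n IH] [|s] //= ns.
by rewrite !IH ?mulr0 ?addr0 // ltnW.
Qed.

Lemma comul_coef_diag n : w n n = a ^+ n.
Proof.
by elim: n => [|n IH] //=; rewrite comul_coef_gt // mulr0 add0r IH exprS.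
Qed.

(** Expanding [(x (x) a + 1 (x) x)^n]: the left tensor factor only records how
    often the first summand was chosen. *)
Lemma comul_expr n : comul H (x ^+ n) = \sum_(s < n.+1) (x ^+ s) ⊗ w n s.
Proof.
have [c1 cM] := comul_morphism H.
elim: n => [|n IH]; first by rewrite expr0 big_ord1.
rewrite exprS cM IH comul_ore_var mulrDl.
have termE : forall s, (x ^+ s) ⊗ w n.+1 s =
   (1 ⊗ x) * (x ^+ s ⊗ w n s)
   + (if s is s'.+1 then (x ⊗ a) * (x ^+ s' ⊗ w n s') else 0).
  case=> [|s]; rewrite ?[_ * _]tens_mul ?mul1r /= ?tensDr ?tens0r //.
  by rewrite [(x ⊗ a) * _]tens_mul exprS.
under [RHS]eq_bigr => i _ do rewrite termE.
rewrite big_split addrC; congr (_ + _).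
  rewrite [RHS]big_ord_recr /= comul_coef_gt // tens0r mulr0 addr0.
  by rewrite mulr_sumr.
by rewrite [RHS]big_ord_recl /= add0r mulr_sumr.
Qed.

Lemma comul_gembM g u : comul H (e g * u) = (e g ⊗ e g) * comul H u.
Proof. by have [_ ->] := comul_morphism H; rewrite comul_gemb. Qed.

Lemma comul_monomial g n :
  comul H (e g * x ^+ n) = \sum_(s < n.+1) (e g * x ^+ s) ⊗ (e g * w n s).
Proof.
rewrite comul_gembM comul_expr mulr_sumr; apply: eq_bigr => s _.
by rewrite [LHS]tens_mul.
Qed.

Lemma coefx_comul_monomial s t g n :
  tmap (coefx s) (coefx t) (comul H (e g * x ^+ n)) = e g ⊗ (e g * coefx t (w n s)).
Proof.
have lc i := linearP (coefx i); have Gg := group_algebra_gemb g.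
rewrite comul_monomial linear_fun_sum; last exact: tmap_linear.
under eq_bigr => i _ do rewrite tmapE // coefx_monomial (coefxMl _ _ Gg).
have [sn|ns] := ltnP s n.+1.
  rewrite (bigD1 (Ordinal sn)) //= eqxx big1 ?addr0 // => i ij.
  by rewrite ifN ?tens0l //; apply: contraNneq ij => ji; apply/eqP/val_inj.
rewrite comul_coef_gt // linear0 mulr0 tens0r big1 // => i _.
by rewrite ltn_eqF ?tens0l // (leq_trans _ ns).
Qed.

Lemma coefx0_comul_coefS m s :
  coefx 0 (w m.+1 s) =
  skew (coefx 0 (w m s)) + (if s is s'.+1 then a * coefx 0 (w m s') else 0).
Proof.
rewrite /= linearD coefx_varM add0r; case: s => [|s]; first by rewrite linear0.
by rewrite coefxMl //; exact: group_algebra_gemb.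
Qed.

Lemma coefxS_comul_coefS m s t :
  coefx t.+1 (w m.+1 s) = twist (coefx t (w m s)) +
  (skew (coefx t.+1 (w m s)) + (if s is s'.+1 then a * coefx t.+1 (w m s') else 0)).
Proof.
rewrite /= linearD coefx_varM -addrA; case: s => [|s]; first by rewrite linear0.
by rewrite coefxMl //; exact: group_algebra_gemb.
Qed.

(** A word in [w n s] has at most [n] letters [x]. *)
Lemma coefx_comul_coef_gt n s t : (n < t)%N -> coefx t (w n s) = 0.
Proof.
elim: n s t => [|n IH] s [|t] // nt.
  rewrite /=; case: (s == 0%N); last exact: linear0.
  by rewrite -[true%:R](expr0 x) coefx_expr.
rewrite coefxS_comul_coefS !IH ?linear0 ?add0r //; last exact: ltnW.
by case: s => // s; rewrite IH ?mulr0 // ltnW.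
Qed.

(** * Grouplike elements and the coradical *)

Lemma gemb_neq0 g : e g != 0.
Proof.
apply/eqP => g0; have := gemb1 H; rewrite -(mulgV g) gembM g0 mul0r.
by move/eqP; rewrite eq_sym oner_eq0.
Qed.

Lemma group_algebra_coord u : kG u -> u != 0 ->
  exists (f : {linear H -> k^o}) g,
    f u != 0 /\ forall h, f (e h) = (h == g)%:R.
Proof.
move=> /lspan_rangeP[s [c [us uE]]] u0.
have [g gs cg] : exists2 g, g \in s & c g != 0.
  apply: contrapT => nc; case/eqP: u0; rewrite uE big_seq big1 // => g gs.
  case: (eqVneq (c g) 0) => [->|cg]; first by rewrite scale0r.
  by case: nc; exists g.
have [f fE] := monomial_linear (fun hj => (hj.1 == g)%:R : k^o).
have fe h : f (e h) = (h == g)%:R by rewrite -[e h]mulr1 -[1](expr0 x) fE.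
exists f, g; split=> //; rewrite uE linear_sum (bigD1_seq g) //= big1 ?addr0.
  by rewrite linearZ /= fe eqxx [_ *: _]mulr1.
by move=> h hg; rewrite linearZ /= fe (negPf hg) scaler0.
Qed.

Lemma top_coef u : u != 0 -> exists2 n, degree_lt n.+1 u & coefx n u != 0.
Proof.
move=> u0; have [d] := degree_ltT u; elim: d => [|d IH] du.
  case/eqP: u0; move: u du; apply: degree_ltP => //.
  exact: (subspace_eq (linearP idfun) (linearP (\0 : {linear H -> H}))).
have [ud|] := eqVneq (coefx d u) 0; last by exists d.
by apply: IH; have := degree_lt_drop du; rewrite ud mul0r subr0.
Qed.

(** For [u] with leading term [c x^n], and [g] in the support of [c], the left
    tensor factor of the coproduct contains [g x^n] only next to [g a^n].  A
    functional that singles out this monomial thus sends the coproduct of [u] to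
    a nonzero multiple of the grouplike element [g a^n], and subcoalgebras are
    stable under such slices. *)
Lemma subcoalgebra_grouplike C u : subcoalgebra C -> C u -> u != 0 ->
  exists g, C (e g).
Proof.
move=> [sC Ccomul] Cu u0; have [n du cn0] := top_coef u0.
have [f [g [fc fe]]] := group_algebra_coord (coefx_in n u) cn0.
have lf : linear (f \o coefx n) by exact: linearP (f \o coefx n).
have := slice_tensor_sub lf sC (Ccomul u Cu).
suff -> : tlift (fun v w => (f \o coefx n) v *: w) (comul H u) =
          f (coefx n u) *: (e g * a ^+ n).
  move=> /(subspaceZ sC (f (coefx n u))^-1).
  rewrite scalerA mulVf // scale1r => Cg; exists (g * ore_elt D ^+ n)%g.
  suff -> : e (g * ore_elt D ^+ n)%g = e g * a ^+ n by [].
  rewrite gembM; congr (_ * _); elim: n {du cn0 fc lf Cg} => [|n IH].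
    by rewrite expg0 gemb1.
  by rewrite expgS gembM IH exprS.
move: u du {Cu u0 cn0 fc}; apply: degree_ltP => [|h m mn].
  apply: subspace_eq => [|c u v]; last by rewrite !linearP scalerDl scalerA.
  by apply: linear_comp (linearP (comul H)); apply/tlift_linear/slice_bilinear.
have bf := slice_bilinear H lf.
rewrite comul_monomial linear_fun_sum; last exact: tlift_linear.
under eq_bigr => i _ do rewrite tliftE // [(f \o _) _]/= coefx_monomial.
rewrite coefx_monomial; move: mn; rewrite ltnS leq_eqVlt => /predU1P[->|mn].
  rewrite big_ord_recr /= eqxx fe comul_coef_diag big1 ?add0r => [|i _].
    by case: eqP => [->|_]; rewrite ?scale0r.
  by rewrite ltn_eqF // linear0 scale0r.
rewrite ltn_eqF // linear0 scale0r big1 // => i _.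
by rewrite ltn_eqF ?linear0 ?scale0r // (leq_trans (ltn_ord i)).
Qed.

Definition point (g : G) : set H := range (fun c => c *: e g).

Lemma point_subspace g : subspace (point g).
Proof.
apply/subspaceP; split; first by exists 0 => //; rewrite scale0r.
move=> c _ _ [u _ <-] [v _ <-]; exists (c * u + v) => //.
by rewrite scalerDl scalerA.
Qed.

Lemma point_gemb g : point g (e g).
Proof. by exists 1 => //; rewrite scale1r. Qed.

Lemma point_subcoalgebra g : subcoalgebra (point g).
Proof.
split; first exact: point_subspace.
move=> _ [c _ <-]; rewrite linearZ /= comul_gemb.
apply: (subspaceZ (lspan_subspace _)); apply: sub_lspan.
by exists (e g); [exact: point_gemb|exists (e g); first exact: point_gemb].
Qed.

Lemma point_min g (A : set H) : subspace A -> A (e g) -> point g `<=` A.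
Proof. by move=> sA Ag _ [c _ <-]; apply: subspaceZ. Qed.

Lemma point_simple g : simple_subcoalgebra (point g).
Proof.
split; first exact: point_subcoalgebra.
  by move=> E; have := point_gemb g; rewrite E /=; apply/eqP/gemb_neq0.
move=> E [sE _] Eg; have [[u [Eu u0]]|nE] := pselect (exists u, E u /\ u != 0).
  right; apply/seteqP; split=> //; apply: point_min => //.
  have [c _ cu] := Eg _ Eu; move: u0; rewrite -cu scaler_eq0 negb_or => /andP[c0 _].
  have := subspaceZ sE c^-1 Eu.
  by rewrite -cu scalerA mulVf // scale1r.
left; apply/seteqP; split=> [u Eu|_ ->] /=; last exact: subspace0.
by apply: contrapT => /eqP u0; apply: nE; exists u.
Qed.

(** A simple subcoalgebra contains a grouplike element ([subcoalgebra_grouplike]),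
    hence is the line spanned by it. *)
Lemma coradicalE : coradical H = kG.
Proof.
apply/seteqP; split; last first.
  apply: group_algebraP => [|g]; first exact: lspan_subspace.
  apply: sub_lspan; exists (point g); first exact: point_simple.
  exact: point_gemb.
apply: lspan_min; first exact: group_algebra_subspace.
move=> u [C [cC C0 Cmin] Cu].
have [->|u0] := eqVneq u 0; first exact: subspace0 group_algebra_subspace.
have [g Cg] := subcoalgebra_grouplike cC Cu u0.
have gC := point_min cC.1 Cg.
have [E|E] := Cmin _ (point_subcoalgebra g) gC.
  have := point_gemb g; rewrite E => /eqP g0.
  by have := gemb_neq0 g; rewrite g0.
by move: Cu; rewrite -E; apply: point_min; [exact: skG|exact: group_algebra_gemb].
Qed.

(** * Gaussian form of the coproduct for a normalized variable *)

Section Normalized.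
Hypothesis Hnorm : normalized H.

Lemma skew_eq0 : q != 1 -> forall u, skew u = 0.
Proof.
move=> q1; have [/(_ q1) a0 _] := Hnorm; apply: monomial_ind => [|g j].
  exact: subspace_eq (linearP _) (linearP (\0 : {linear H -> H})).
by rewrite skew_monomial a0 scale0r.
Qed.

(** Either [q <> 1] and [skew] vanishes, or [q = 1], so that [chi(g a) = chi(g)]
    and [twist] multiplies [g (1 - a)] by the scalar [chi(g)]. *)
Lemma twist_skew u : twist (skew u) = q *: skew (twist u).
Proof.
have [q1|q1] := eqVneq q 1; last by rewrite !skew_eq0 // linear0 scaler0.
rewrite q1 scale1r; move: u; apply: monomial_ind => [|g j].
  by apply: subspace_eq => c u v; rewrite !linearP.
rewrite skew_monomial twist_monomial !linearZ /= skew_gemb mulrBr mulr1 -gembM.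
rewrite linearB /= !twist_gemb ore_charM q1 mulr1 -scalerBr !scalerA.
by rewrite mulrC.
Qed.

(** The words of [w m s] contribute to the constant coefficient an element of
    [k[a]] on which [twist] acts by the scalar [q^m]: every letter, whether it
    stays as an [a] or is absorbed through [skew], contributes a factor [q]. *)
Lemma twist_comul_coef m s :
  twist (coefx 0 (w m s)) = q ^+ m *: coefx 0 (w m s).
Proof.
elim: m s => [|m IH] s.
  rewrite expr0 scale1r /=; case: (s == 0%N); last by rewrite !linear0.
  by rewrite -[true%:R](expr0 x) coefx_expr eqxx -(gemb1 H) twist_gemb
    ore_char1 scale1r.
rewrite coefx0_comul_coefS linearD twist_skew // IH linearZ scalerA -exprS scalerDr.
congr (_ + _); case: s => [|s]; first by rewrite linear0 scaler0.
by rewrite twist_ore_elt IH -scalerAr scalerA exprS.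
Qed.

(** The q-binomial theorem.  An [x] of a word either moves to the right end
    through [twist] or is absorbed by [skew]; prefixing an [a] or applying
    [skew] q-commutes with passing an [x] to the right, so the [t] letters that
    reach the right end can be collected, and the coefficient of [X^t] in
    [gauss q n] counts the ways to do so, up to the power of [q] on the left. *)
Lemma coefx_comul_coef n s t : (t <= n)%N ->
  q ^+ 'C(t, 2) *: coefx t (w n s) = (gauss q n)`_t *: coefx 0 (w (n - t) s).
Proof.
elim: n s t => [|n IH] s [|t] // tn; rewrite ?gauss_coef0 ?subn0 //.
rewrite coefxS_comul_coefS coef_gaussS subSS scalerDr scalerDl addrC.
congr (_ + _); last first.
  rewrite binS bin1 addnC exprD -scalerA -[q ^+ 'C(t, 2) *: _]linearZ /= IH //.
  rewrite linearZ /= twist_comul_coef !scalerA mulrAC -exprD subnKC // mulrC.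
move: tn; rewrite ltnS leq_eqVlt => /predU1P[->|tn].
  rewrite gauss_coef_gt // scale0r coefx_comul_coef_gt // linear0 add0r.
  by case: s => [|s]; rewrite ?coefx_comul_coef_gt ?mulr0 ?scaler0.
rewrite -(subnSK tn) coefx0_comul_coefS !scalerDr -![_ *: skew _]linearZ /= IH //.
congr (_ + _); case: s => [|s]; first by rewrite !scaler0.
by rewrite !scalerAr IH.
Qed.

Lemma coefx_comul_coef_small n s t : (n < s + t)%N -> coefx t (w n s) = 0.
Proof.
move=> nst; have [tn|] := leqP t n; last exact: coefx_comul_coef_gt.
have /eqP := coefx_comul_coef s tn.
rewrite (@comul_coef_gt (n - t)); last by rewrite ltn_subLR // addnC.
rewrite linear0 scaler0.
by rewrite scaler_eq0 expf_eq0 (negPf (chi_neq0 _)) andbF => /eqP.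
Qed.

Lemma group_algebra_ore_eltX n : kG (a ^+ n).
Proof.
elim: n => [|n IH]; first exact: group_algebra1.
by rewrite exprS; apply: group_algebraM IH; apply: group_algebra_gemb.
Qed.

(** Extraction of the terms [x^s (x) x^t] of top total degree: they depend on the
    leading coefficient only, as [coefx t (w n s)] vanishes for [n < s + t]. *)
Lemma coefx_comul s t u : degree_lt (s + t).+1 u ->
  q ^+ 'C(t, 2) *: tmap (coefx s) (coefx t) (comul H u) =
  (gauss q (s + t))`_t *: (comul H (coefx (s + t) u) * (1 ⊗ a ^+ s)).
Proof.
have lc i := linearP (coefx i); have lD := linearP (comul H).
move: u; apply: degree_ltP => [|g n].
  apply: subspace_eq; apply: linear_scale.
    by apply: linear_comp lD; apply: tmap_linear.
  apply: (@linear_comp _ _ _ _ _ (comul H \o coefx (s + t))).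
    exact: tens_mulr_linear.
  exact: linear_comp.
rewrite ltnS leq_eqVlt coefx_comul_monomial coefx_monomial => /predU1P[->|nst].
  rewrite eqxx comul_gemb [_ * (1 ⊗ _)]tens_mul mulr1 -!tensZr scalerAr.
  rewrite coefx_comul_coef ?leq_addl // addnK comul_coef_diag scalerAr.
  rewrite -[X in coefx 0 X]mulr1 -[1](expr0 x) coefx_term //.
  exact: group_algebra_ore_eltX.
rewrite coefx_comul_coef_small // mulr0 tens0r ltn_eqF // (linear0 (comul H)) mul0r.
by rewrite !scaler0.
Qed.

Lemma comul_mul_ore_eltX_eq0 u n : comul H u * (1 ⊗ a ^+ n) = 0 -> u = 0.
Proof.
move=> E; have E' : comul H u = 0.
  have [b ab] : exists b, a ^+ n * b = 1.
    exists (e (ore_elt D)^-1%g ^+ n).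
    rewrite -exprMn_comm -?gembM ?mulgV ?gemb1 ?expr1n //.
    by rewrite /GRing.comm -!gembM mulgV mulVg.
  have := congr1 (fun t => t * (1 ⊗ b)) E; rewrite /= mul0r -mulrA.
  by rewrite [(1 ⊗ _) * _]tens_mul mulr1 ab mulr1.
rewrite -(counitl u) E'; have := tlift_linear (slice_bilinear H (linearP (counit H))).
move=> lf; exact: (subspace0 (subspace_eq lf (linearP (\0 : {linear _ -> H})))).
Qed.

(** * The first term of the coradical filtration *)
Local Notation H1 := (coradical_filtration H 1).

Lemma filtration1E :
  H1 = comul H @^-1` add_sub (tensor_sub setT kG) (tensor_sub kG setT).
Proof. by rewrite /= coradicalE. Qed.

Lemma filtration1_subspace : subspace H1.
Proof.
rewrite filtration1E; apply: subspace_preim (linearP (comul H)) _.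
by apply: add_sub_subspace; apply: lspan_subspace.
Qed.

(** For [s > 0] the coefficient of [x^t] in [w n s] vanishes for [0 < t < n] by
    primitivity of the degree and for [t = n] since [w 0 s = 0]; so [w n s] lies
    in [kG].  The remaining term [s = 0] has its left factor in [kG]. *)
Lemma filtration1_term h n : primitive_degree q n -> kG h -> H1 (h * x ^+ n).
Proof.
move=> pn Gh; move: h Gh; apply: group_algebraP => [|g].
  exact: subspace_preim (mulrr_linear _) filtration1_subspace.
rewrite filtration1E /= comul_monomial big_ord_recl addrC.
exists (\sum_(i < n) (e g * x ^+ (lift ord0 i)) ⊗ (e g * w n (lift ord0 i))).
  apply: (subspace_sum (lspan_subspace _)) => i _; apply: sub_lspan.
  exists (e g * x ^+ (lift ord0 i)) => //.
  exists (e g * w n (lift ord0 i)) => //.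
  apply: group_algebraM; first exact: group_algebra_gemb.
  apply: coefx_group_algebra => t t0.
  have [tn|] := leqP t n; last exact: coefx_comul_coef_gt.
  apply/eqP; have := coefx_comul_coef (lift ord0 i) tn => /eqP.
  suff -> : (gauss q n)`_t *: coefx 0 (w (n - t) (lift ord0 i)) = 0.
    by rewrite scaler_eq0 expf_eq0 (negPf (chi_neq0 _)) andbF.
  move: tn; rewrite leq_eqVlt => /predU1P[->|tn].
    by rewrite subnn comul_coef_gt // linear0 scaler0.
  by rewrite pn ?scale0r // t0.
exists ((e g * x ^+ 0) ⊗ (e g * w n 0)) => //.
apply: sub_lspan; exists (e g * x ^+ 0); last by exists (e g * w n 0).
by rewrite mulr1; apply: group_algebra_gemb.
Qed.

Lemma coefx_mixed s t r : (0 < s)%N -> (0 < t)%N ->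
  add_sub (tensor_sub setT kG) (tensor_sub kG setT) r ->
  tmap (coefx s) (coefx t) r = 0 :> tensor H H.
Proof.
move=> s0 t0 [u Tu [v Tv <-]].
have lc i := linearP (coefx i).
have lt := tmap_linear (lc s) (lc t).
have G0 i h : (0 < i)%N -> kG h -> coefx i h = 0.
  by move=> i0 Gh; rewrite -[h]mulr1 -(expr0 x) coefx_term // ltn_eqF.
have kill (A B : set H) : (forall y z, A y -> B z -> coefx s y ⊗ coefx t z = 0) ->
    forall r', tensor_sub A B r' -> tmap (coefx s) (coefx t) r' = 0.
  move=> AB; apply: lspan_min.
    exact: subspace_eq lt (linearP (\0 : {linear _ -> tensor H H})).
  by move=> _ [y Ay [z Bz <-]]; rewrite /= tmapE //; apply: AB.
have := lt 1 u v; rewrite !scale1r => ->.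
rewrite (kill _ _ _ _ Tu) ?(kill _ _ _ _ Tv) ?addr0 // => y z Ay Bz.
  by rewrite (G0 s) // tens0l.
by rewrite (G0 t) // tens0r.
Qed.

(** By induction on the degree of [u].  A leading term of primitive degree can be
    subtracted, since it lies in [H1]; one of any other degree must vanish, since
    it would produce a term [x^s (x) x^t] with [s, t > 0] in the coproduct. *)
Lemma filtration1_coefx u n : H1 u -> ~ primitive_degree q n -> coefx n u = 0.
Proof.
move=> + np; have [d du] := degree_ltT u; elim: d u du => [|d IH] u du Hu.
  exact: coefx_degree_lt du _.
have [pd|npd] := pselect (primitive_degree q d).
  have Hud : H1 (u - coefx d u * x ^+ d).
    apply: (subspaceB filtration1_subspace) => //.
    by apply: filtration1_term => //; exact: coefx_in.
  have := IH _ (degree_lt_drop du) Hud; rewrite linearB /= coefx_term ?subr0 //.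
    by case: eqP => [E|_]; rewrite ?subr0 //; case: np; rewrite -E.
  exact: coefx_in.
apply: IH => //; suff d0 : coefx d u = 0.
  by have := degree_lt_drop du; rewrite d0 mul0r subr0.
have [t [/andP[t0 td] gt]] : exists t, (0 < t < d)%N /\ (gauss q d)`_t != 0.
  apply: contrapT => nt; apply: npd => t td; apply/eqP; apply: contrapT => gt.
  by apply: nt; exists t; split=> //; apply/negP.
have dE : d = (d - t + t)%N by rewrite subnK // ltnW.
move: (du); rewrite {1}dE => /coefx_comul.
rewrite coefx_mixed ?subn_gt0 //; last by move: Hu; rewrite filtration1E.
rewrite scaler0 -dE => /esym/eqP; rewrite scaler_eq0 (negPf gt) /= => /eqP.
exact: comul_mul_ore_eltX_eq0.
Qed.

Section Degrees.
Variables (I : eqType) (f : I -> nat).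
Hypothesis f_inj : injective f.
Hypothesis fP : forall i, primitive_degree q i <-> exists j, f j = i.

Lemma filtration1_span :
  H1 = lspan (\bigcup_j times_var (H := H) kG (f j)).
Proof.
apply/seteqP; split=> [u Hu|].
  have [d du] := degree_ltT u; rewrite (coefx_expansion du).
  apply: (subspace_sum (lspan_subspace _)) => i _.
  have [[j fj]|nf] := pselect (exists j, f j = i).
    apply: sub_lspan; exists j => //; exists (coefx i u); first exact: coefx_in.
    by rewrite fj.
  rewrite filtration1_coefx ?mul0r // ?fP //.
  exact: subspace0 (lspan_subspace _).
apply: lspan_min; first exact: filtration1_subspace.
move=> _ [j _ [h Gh <-]].
by apply: filtration1_term => //; apply/fP; exists j.
Qed.

Lemma filtration1_direct_sum :
  is_direct_sum (fun j => times_var (H := H) kG (f j)) H1.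
Proof.
split; first exact: filtration1_span.
move=> s v us vA sum0 j js; have [h Gh vj] := vA j.
suff h0 : h = 0 by rewrite -vj h0 mul0r.
have := congr1 (coefx (f j)) sum0; rewrite linear0 linear_sum => <-.
rewrite (bigD1_seq j) //= -vj coefx_term // eqxx big1 ?addr0 // => i ij.
have [h' Gh' <-] := vA i; rewrite coefx_term // ifN //.
by apply: contra_neq ij => /f_inj.
Qed.

End Degrees.

(** * Rank *)

Lemma gemb_hopf_subalgebra : hopf_subalgebra kG.
Proof.
split.
- split=> [|c u v|u v]; rewrite !inE; first exact: group_algebra1.
    by move=> Gu Gv; apply: (subspaceD skG) => //; apply: (subspaceZ skG).
  exact: group_algebraM.
- apply: group_algebraP => [|g].
    exact: subspace_preim (linearP _) (lspan_subspace _).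
  rewrite /= comul_gemb; apply: sub_lspan.
  exists (e g); first exact: group_algebra_gemb.
  by exists (e g) => //; exact: group_algebra_gemb.
- apply: group_algebraP => [|g]; first exact: subspace_preim (linearP _) skG.
  by rewrite /= antipode_gemb; apply: group_algebra_gemb.
Qed.

Lemma filtration1_gemb g : H1 (e g).
Proof.
have := filtration1_term (primitive_degree_le1 q (leqnSn 0)) (group_algebra_gemb g).
by rewrite mulr1.
Qed.

Lemma filtration1_var : H1 x.
Proof.
have := filtration1_term (primitive_degree_le1 q (leqnn 1)) group_algebra1.
by rewrite mul1r.
Qed.

Lemma hopfOre_rank_defined : rank_defined H.
Proof.
split; first by rewrite /= coradicalE; exact: gemb_hopf_subalgebra.
rewrite /generates -subTset => u _ B [[B1 Blin BM] HB].
have sB : subspace B.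
  split=> //; have := Blin (-1) 1 1 B1 B1; by rewrite scaleN1r addNr.
have BM' y z : B y -> B z -> B (y * z).
  by move=> By Bz; have := BM y z; rewrite !inE; apply.
move: u; apply: (monomial_ind sB) => g i; apply: (BM').
  exact/HB/filtration1_gemb.
elim: i => [|i IH]; first by move: B1; rewrite inE.
by rewrite exprS; apply: (BM') => //; apply/HB/filtration1_var.
Qed.

(** These functionals vanish on the relations that define the tensor product over
    [kG], and the [x^n] are dual to them. *)
Definition trivial_coef (n : nat) : tensor k^o H -> k^o :=
  tlift (fun c u => c * counit H (coefx n u) : k^o).

Lemma trivial_coef_bilinear n :
  bilinear_map (fun (c : k^o) (u : H) => c * counit H (coefx n u) : k^o).
Proof.
split=> [u d b c|c d u v] /=; first by rewrite mulrDl -scalerAl.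
by rewrite !linearP /= mulrDr scalerAr.
Qed.

Lemma trivial_coef_linear n : linear (trivial_coef n).
Proof. exact/tlift_linear/trivial_coef_bilinear. Qed.

Lemma trivial_coefE n c u : trivial_coef n (c ⊗ u) = c * counit H (coefx n u).
Proof. by rewrite /trivial_coef tliftE //; apply: trivial_coef_bilinear. Qed.

Lemma trivial_coef_balanced n M t :
  balanced_relations kG M t -> trivial_coef n t = 0.
Proof.
have lt := trivial_coef_linear n; move: t; apply: lspan_min.
  exact: subspace_eq lt (linearP (\0 : {linear _ -> k^o})).
move=> _ [c [h [m [Gh _ ->]]]] /=.
rewrite (linear_funB _ _ lt) !trivial_coefE coefxMl //.
have [_ ->] := counit_morphism H.
by rewrite mulrA subrr.
Qed.

Lemma trivial_coef_expr m n : trivial_coef m (1 ⊗ x ^+ n) = (n == m)%:R.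
Proof.
rewrite trivial_coefE coefx_expr mul1r; case: (n == m); last by rewrite linear0.
by have [-> _] := counit_morphism H.
Qed.

(** The classes of [1 (x) x^n], [n] a primitive degree, form a basis: they span
    because [c (x) h x^n] is congruent to [c eps(h) (x) x^n], and the functionals
    [trivial_coef] separate them. *)
Lemma hopfOre_has_rank n (f : 'I_n.+1 -> nat) : injective f ->
  (forall i, primitive_degree q i <-> exists j, f j = i) -> has_rank H n.
Proof.
move=> f_inj fP; split; first exact: hopfOre_rank_defined.
rewrite /dim_trivial_tensor [coradical_filtration H 0]coradicalE.
pose v i : tensor k^o H := 1 ⊗ x ^+ f i.
have vE i j : trivial_coef (f i) (v j) = (j == i)%:R.
  by rewrite trivial_coef_expr (inj_eq f_inj).
exists v => [i|u Au].
  apply: sub_lspan; exists 1 => //; exists (x ^+ f i) => //.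
  rewrite -[x ^+ _]mul1r; apply: filtration1_term group_algebra1.
  by apply/fP; exists i.
have lt i := trivial_coef_linear (f i).
have coordE (c : 'I_n.+1 -> k) j :
    trivial_coef (f j) (\sum_i c i *: v i) = c j.
  rewrite linear_fun_sum // (bigD1 j) //= big1 => [|i ij].
    by rewrite (linear_funZ _ _ (lt j)) vE eqxx addr0 [_ *: _]mulr1.
  by rewrite (linear_funZ _ _ (lt j)) vE (negPf ij) scaler0.
exists (\row_i trivial_coef (f i) u); split; last first.
  move=> c Bc; apply/rowP => j; rewrite mxE -(coordE (c ord0) j).
  apply/eqP; rewrite -subr_eq0 -(linear_funB _ _ (lt j)); apply/eqP.
  exact: trivial_coef_balanced Bc.
under eq_bigr => i _ do rewrite mxE.
pose r (t : tensor k^o H) : tensor k^o H :=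
  t - \sum_i (trivial_coef (f i) t : k) *: v i.
have lr : linear r.
  move=> c t s; rewrite /r scalerBr addrACA -opprD scaler_sumr -big_split.
  congr (_ - _); apply: eq_bigr => i _ /=.
  by rewrite lt scalerDl scalerA.
have sB := lspan_subspace.
rewrite -[u - _]/(r u); move: u Au; apply: lspan_min.
  exact: subspace_preim lr (sB _ _ _).
move=> _ [c _ [m Hm <-]] /=; move: m Hm; rewrite [H1](filtration1_span fP).
have lc : linear (fun m : H => r (c ⊗ m)).
  by move=> d y z; rewrite tensDr tensZr lr.
apply: lspan_min; first exact: subspace_preim lc (sB _ _ _).
move=> _ [j _ [h Gh <-]] /=; rewrite /r (bigD1 j) //= big1 => [|i ij].
  rewrite trivial_coefE coefx_term // eqxx addr0 -tensZl [_ *: 1]mulr1.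
  rewrite -opprB -scaleN1r; apply: (subspaceZ (sB _ _ _)); apply: sub_lspan.
  exists c, h, (x ^+ f j); split=> //.
  rewrite -[x ^+ _]mul1r; apply: filtration1_term group_algebra1.
  by apply/fP; exists j.
rewrite trivial_coefE coefx_term // (inj_eq f_inj) eq_sym (negPf ij).
by rewrite linear0 mulr0 scale0r.
Qed.

(** A basis of [n] classes would factor the identity matrix of size [n + 1], formed
    by the values of [trivial_coef (f l)] at [1 (x) x^(f j)], through [k^n]. *)
Lemma hopfOre_infinite_rank (f : nat -> nat) : injective f ->
  (forall i, primitive_degree q (f i)) -> has_infinite_rank H.
Proof.
move=> f_inj fP; split=> [|n]; first exact: hopfOre_rank_defined.
rewrite /dim_trivial_tensor [coradical_filtration H 0]coradicalE.
case=> v _ vP.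
have lt i := trivial_coef_linear (f i).
pose u j : tensor k^o H := 1 ⊗ x ^+ f j.
have uA j : tensor_sub setT H1 (u j).
  apply: sub_lspan; exists 1 => //; exists (x ^+ f j) => //.
  by rewrite -[x ^+ _]mul1r; apply: filtration1_term (fP j) group_algebra1.
have {vP} /choice[c cP] j : exists c : 'rV_n,
    balanced_relations kG H1 (u j - \sum_i c ord0 i *: v i).
  by have [c [Bc _]] := vP _ (uA j); exists c.
pose C : 'M[k]_(n.+1, n) := \matrix_(j, i) c j ord0 i.
pose M : 'M[k]_(n, n.+1) := \matrix_(i, j) trivial_coef (f j) (v i).
suff /mulmx1_min : C *m M = 1%:M by rewrite ltnn.
apply/matrixP => j l; rewrite !mxE.
have := trivial_coef_balanced (f l) (cP j); rewrite (linear_funB _ _ (lt l)).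
move/subr0_eq; rewrite trivial_coef_expr (inj_eq f_inj) => ->.
rewrite linear_fun_sum //; apply: eq_bigr => i _.
by rewrite (linear_funZ _ _ (lt l)) !mxE.
Qed.

End Normalized.

End HopfOre.

(** * Primitive degrees and rank in each characteristic *)

Lemma prim_root_one (k : fieldType) : 1.-primitive_root (1 : k).
Proof.
have [m] := prim_order_exists (isT : (0 < 1)%N) (expr1n k 1).
by rewrite dvdn1 => prim1 /eqP m1; rewrite m1 in prim1.
Qed.

Section RankCases.
Variables (k : fieldType) (G : groupType) (D : hopfOreDatum k G).
Variable H : hopfOreExtension D.
Hypothesis Hnorm : normalized H.
Local Notation q := (ore_char D (ore_elt D)).
Local Notation kG := (group_algebra H).
Local Notation H1 := (coradical_filtration H 1).

Lemma times_var0 (A : set H) : times_var A 0 = A.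
Proof.
apply/seteqP; split=> [_ [h Ah <-]|h Ah]; first by rewrite mulr1.
by exists h; rewrite ?mulr1.
Qed.

Lemma rank1_no_primitive_degree : (forall i, (1 < i)%N -> ~ primitive_degree q i) ->
  has_rank H 1 /\ is_direct_sum (tnth [tuple kG; times_var (H := H) kG 1]) H1.
Proof.
move=> nop; pose f (j : 'I_2) : nat := j.
have f_inj : injective f by exact: val_inj.
have fP i : primitive_degree q i <-> exists j, f j = i.
  split=> [pi|[j <-]]; last by apply: primitive_degree_le1; apply: (ltn_ord j).
  have i2 : (i < 2)%N by rewrite ltnNge; apply/negP => /nop.
  by exists (Ordinal i2).
split; first exact: hopfOre_has_rank f_inj fP.
suff -> : tnth [tuple kG; times_var kG 1] = (fun j => times_var kG (f j)).
  exact: filtration1_direct_sum.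
by apply: funext => -[[|[|//]] j2]; rewrite (tnth_nth set0) //= times_var0.
Qed.

Lemma rank2_one_primitive_degree n : (1 < n)%N ->
  (forall i, (1 < i)%N -> primitive_degree q i <-> i = n) ->
  has_rank H 2 /\
  is_direct_sum (tnth [tuple kG; times_var (H := H) kG 1; times_var kG n]) H1.
Proof.
move=> n1 pn; pose f (j : 'I_3) : nat := nth 0%N [:: 0; 1; n]%N j.
have f_inj : injective f.
  move=> i j /eqP; rewrite nth_uniq // => [/eqP/val_inj//|].
  by rewrite /= !inE; case: n n1 {pn f} => [|[|n]].
have fP i : primitive_degree q i <-> exists j, f j = i.
  have [i1|i1] := leqP i 1.
    split=> _; last exact: primitive_degree_le1.
    have i3 : (i < 3)%N by apply: leq_trans i1 _.
    by exists (Ordinal i3); case: i i1 i3 => [|[|]].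
  rewrite pn //; split=> [->|[[[|[|[|//]]] j3] fi]].
  - by exists (inord 2); rewrite /f inordK.
  - by rewrite -fi in i1.
  - by rewrite -fi in i1.
  by rewrite -fi.
split; first exact: hopfOre_has_rank f_inj fP.
suff -> : tnth [tuple kG; times_var kG 1; times_var kG n] =
          (fun j => times_var kG (f j)).
  exact: filtration1_direct_sum.
by apply: funext => -[[|[|[|//]]] j3]; rewrite (tnth_nth set0) //= times_var0.
Qed.

Section PositiveCharacteristic.
Variables (p N : nat).
Hypotheses (chp : p \in [pchar k]) (primq : N.-primitive_root q).

Let p_gt1 : (1 < p)%N := prime_gt1 (pcharf_prime chp).
Let N_gt0 : (0 < N)%N := prim_order_gt0 primq.

Lemma pchar_degree_inj : injective (fun r => N * p ^ r)%N.
Proof.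
by move=> r s /eqP; rewrite eqn_pmul2l // => /eqP/expnI; apply.
Qed.

Lemma pchar_degreeP i : (1 < i)%N ->
  primitive_degree q i <-> exists r, (N * p ^ r)%N = i.
Proof.
move=> i1; split=> [pi|[r <-]]; last exact: primitive_degree_pchar.
have [M primM Mi] := primitive_degree_root i1 pi.
have NM : N = M.
  by apply/eqP; rewrite eqn_dvd (prim_order_dvd primq) (prim_expr_order primM)
    (prim_order_dvd primM) (prim_expr_order primq) !eqxx.
rewrite -NM in Mi.
by have [r ->] := primitive_degree_pcharP primq chp i1 Mi pi; exists r.
Qed.

Lemma infinite_rank_pchar : has_infinite_rank H.
Proof.
apply: hopfOre_infinite_rank pchar_degree_inj _ => // r.
exact: primitive_degree_pchar.
Qed.

Lemma filtration1_pchar_root : (1 < N)%N ->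
  is_direct_sum (fun i : 'I_2 + nat =>
    match i with
    | inl j => tnth [tuple kG; times_var (H := H) kG 1] j
    | inr r => times_var kG (N * p ^ r)
    end) H1.
Proof.
move=> N1; pose f (i : 'I_2 + nat) : nat :=
  match i with inl j => j | inr r => (N * p ^ r)%N end.
have Npr r : (1 < N * p ^ r)%N.
  by apply: (leq_trans N1); rewrite leq_pmulr // expn_gt0 ltnW.
have f_inj : injective f.
  move=> [i|r] [j|s] /=; first by move/val_inj->.
  - by move=> E; have := Npr s; rewrite -E ltnNge -ltnS ltn_ord.
  - by move=> E; have := Npr r; rewrite E ltnNge -ltnS ltn_ord.
  - by move/pchar_degree_inj->.
have fP i : primitive_degree q i <-> exists j, f j = i.
  have [i1|i1] := leqP i 1.
    split=> _; last exact: primitive_degree_le1.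
    by exists (inl (Ordinal (i1 : (i < 2)%N))).
  rewrite pchar_degreeP //; split=> [[r <-]|[[j|r] fi]]; first by exists (inr r).
    by have := ltn_ord j; rewrite ltnNge [nat_of_ord j]fi i1.
  by exists r.
suff -> : (fun i : 'I_2 + nat => match i with
    | inl j => tnth [tuple kG; times_var kG 1] j
    | inr r => times_var kG (N * p ^ r) end) = (fun j => times_var kG (f j)).
  exact: filtration1_direct_sum.
apply: funext => -[[[|[|//]] j2]|r] //; rewrite (tnth_nth set0) //=.
by rewrite times_var0.
Qed.

End PositiveCharacteristic.

Lemma filtration1_pchar_unipotent p : p \in [pchar k] -> q = 1 ->
  is_direct_sum (fun i : option nat =>
    if i is Some r then times_var (H := H) kG (p ^ r) else kG) H1.
Proof.
move=> chp q1; have primq : 1.-primitive_root q by rewrite q1; exact: prim_root_one.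
pose f (i : option nat) : nat := if i is Some r then (p ^ r)%N else 0%N.
have p0 r : (0 < p ^ r)%N by rewrite expn_gt0 prime_gt0 // (pcharf_prime chp).
have f_inj : injective f.
  move=> [r|] [s|] //=; last by move=> E; have := p0 s; rewrite -E.
    have := @pchar_degree_inj p 1 chp primq r s.
    by rewrite /= !mul1n => E /E ->.
  by move=> E; have := p0 r; rewrite E.
have fP i : primitive_degree q i <-> exists j, f j = i.
  have [i1|i1] := leqP i 1.
    split=> _; last exact: primitive_degree_le1.
    by case: i i1 => [|[|//]] _; [exists None|exists (Some 0%N)].
  rewrite (pchar_degreeP chp primq i1); split=> [[r <-]|[[r|] fi]].
  - by exists (Some r); rewrite /f mul1n.
  - by exists r; rewrite mul1n.
  - by rewrite -fi in i1.
suff -> : (fun i : option nat => if i is Some r then times_var kG (p ^ r) else kG)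
    = (fun j => times_var kG (f j)).
  exact: filtration1_direct_sum.
by apply: funext => -[r|] //=; rewrite times_var0.
Qed.

End RankCases.

Theorem theorem2p2 (k : fieldType) (G : groupType) (D : hopfOreDatum k G)
    (H : hopfOreExtension D) (Hnorm : normalized H) :
  let q := ore_char D (ore_elt D) in
  let H0 := coradical_filtration H 0 in
  let H1 := coradical_filtration H 1 in
  [/\ H0 = group_algebra H,
      [pchar k] =i pred0 ->
        (forall n : nat, (2 <= n)%N -> n.-primitive_root q ->
           has_rank H 2 /\
           is_direct_sum
             (tnth [tuple H0; times_var H0 1; times_var H0 n]) H1) /\
        ((forall n : nat, (2 <= n)%N -> ~~ n.-primitive_root q) ->
           has_rank H 1 /\
           is_direct_sum (tnth [tuple H0; times_var H0 1]) H1)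
    & forall p : nat, p \in [pchar k] ->
        [/\ (forall N : nat, (2 <= N)%N -> N.-primitive_root q ->
               has_infinite_rank H /\
               is_direct_sum
                 (fun i : 'I_2 + nat =>
                    match i with
                    | inl j => tnth [tuple H0; times_var H0 1] j
                    | inr r => times_var H0 (N * p ^ r)
                    end) H1),
            (q = 1 ->
               has_infinite_rank H /\
               is_direct_sum
                 (fun i : option nat =>
                    if i is Some r then times_var H0 (p ^ r) else H0) H1)
          & (q != 1 ->
             (forall N : nat, (2 <= N)%N -> ~~ N.-primitive_root q) ->
               has_rank H 1 /\
               is_direct_sum (tnth [tuple H0; times_var H0 1]) H1)]].
Proof.
move=> q; rewrite [coradical_filtration H 0]coradicalE => H0 H1.
split=> // [ch0|p chp].
  have degP i : (1 < i)%N -> primitive_degree q i -> i.-primitive_root q.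
    move=> i1 pi; have [N primN Ni] := primitive_degree_root i1 pi.
    by rewrite (primitive_degree_pchar0 primN ch0 i1 Ni pi).
  split=> [n n1 primn|nop].
    apply: rank2_one_primitive_degree => // i i1; split=> [/(degP i i1) primi|->].
      apply/eqP; rewrite eqn_dvd (prim_order_dvd primi) (prim_expr_order primn).
      by rewrite (prim_order_dvd primn) (prim_expr_order primi) !eqxx.
    exact: primitive_degree_order.
  by apply: rank1_no_primitive_degree => // i i1 /(degP i i1); apply/negP/nop.
split=> [N N1 primN|q1|q1 nop].
- by split; [exact: infinite_rank_pchar chp primN|exact: filtration1_pchar_root].
- split; last exact: filtration1_pchar_unipotent.
  have prim1 : 1.-primitive_root q by rewrite q1; exact: prim_root_one.
  exact: infinite_rank_pchar chp prim1.
apply: rank1_no_primitive_degree => // i i1 pi.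
have [N primN Ni] := primitive_degree_root i1 pi.
have := prim_order_gt0 primN; rewrite leq_eqVlt => /predU1P[N1|/nop/negP//].
by case/eqP: q1; rewrite -[LHS]expr1; have := prim_expr_order primN; rewrite -N1.
Qed.
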